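(* Let $(\mathcal M,\mathcal N,\mathcal D)$ be a (not necessarily full) Cartan triple with faithful normal conditional expectation $E:\mathcal M\to\mathcal N$, and let $\mathcal Y\subseteq\mathcal{GN}(\mathcal M,\mathcal D)$ be a maximal $E$-orthogonal subset. Let $\Lambda$ be the set of all finite subsets of $\mathcal Y$ directed by inclusion. For $x\in\mathcal M$ and $F\in\Lambda$, let $x_F:=\sum_{u\in F}uE(u^*x)$. Then the net $(x_F)_{F\in\Lambda}$ converges in the Bures topology to $x$.
   Context: Von Neumann subalgebras are understood to contain the unit of the ambient algebra. For a von Neumann algebra $\mathcal M$ and a von Neumann subalgebra $\mathcal L\subseteq\mathcal M$, put $\mathcal{GN}(\mathcal M,\mathcal L)=\{v\in\mathcal M: v\text{ is a partial isometry and } v^*\mathcal Lv\cup v\mathcal Lv^*\subseteq\mathcal L\}$; $\mathcal L$ is regular in $\mathcal M$ if the linear span of $\mathcal{GN}(\mathcal M,\mathcal L)$ is weak-$*$ dense in $\mathcal M$. A Cartan triple $(\mathcal M,\mathcal N,\mathcal D)$ consists of von Neumann algebras such that (1) $\mathcal D$ is an abelian and regular von Neumann subalgebra of $\mathcal M$; (2) $\mathcal N$ is the relative commutant of $\mathcal D$ in $\mathcal M$; (3) there exists a faithful normal conditional expectation $E:\mathcal M\to\mathcal N$. It is full if $\mathcal D=\mathcal Z(\mathcal N)$. A subset $\mathcal Y\subseteq\mathcal{GN}(\mathcal M,\mathcal D)$ is $E$-orthogonal if $E(v^*w)=0$ whenever $v,w\in\mathcal Y$ and $v\neq w$. The ($E$-)Bures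 topology on $\mathcal M$ is the locally convex topology determined by the seminorms $x\mapsto\rho(E(x^*x))^{1/2}$, $\rho\in\mathcal N_*^+$ (positive normal functionals on $\mathcal N$). *)

(* Defs.v *)
From HB Require Import structures.
From mathcomp Require Import all_boot all_order all_algebra sesquilinear finmap.
From mathcomp Require Import complex.
From mathcomp Require Import boolp classical_sets functions filter reals.
From mathcomp Require Import topology normedtype sequences.

Set Implicit Arguments.
Unset Strict Implicit.
Unset Printing Implicit Defensive.

Import Order.TTheory GRing.Theory Num.Theory Num.Def.
Import numFieldNormedType.Exports.

Local Open Scope classical_set_scope.
Local Open Scope complex_scope.
Local Open Scope ring_scope.

(* The inner product is linear in the first argument and conjugate-linear in
   the second one. As [H] is a normed module over R[i], norms are elements of
   R[i] (nonnegative reals); accordingly all seminorms below, and the radii of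
   their balls, take values in R[i], where [0 < e] forces [e] to be real. *)
Record hilbertSpace (R : realType) := HilbertSpace {
  hilbert_sort :> completeNormedModType R[i];
  hdot : {dot hilbert_sort for (@conjC R[i])};
  hdot_norm : forall u : hilbert_sort, `|u| ^+ 2 = hdot u u }.

Arguments hdot {R h}.

Section SeminormTopology.
Context {C : numFieldType} {V : lmodType C}.

(* Neighbourhoods of [x] in [A], for the locally convex topology that a family
   [P] of seminorms on the subspace [A] of [V] determines. The values of the
   seminorms outside of [A] play no role. *)
Definition seminorm_nbhs (A : set V) (P : set (V -> C)) (x : V) :
    set_system V :=
  [set U | exists (n : nat) (p : 'I_n -> V -> C) (e : C),
    [/\ forall i, P (p i), 0 < e
      & forall y, A y -> (forall i, p i (y - x) < e) -> U y]].

Definition linear_span (S : set V) : set V :=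
  [set x | exists (n : nat) (c : 'I_n -> C) (s : 'I_n -> V),
    (forall i, S (s i)) /\ x = \sum_(i < n) c i *: s i].

End SeminormTopology.

Definition finite_subsets_filter (T : choiceType) : set_system {fset T} :=
  filter_from [set: {fset T}] (fun F0 => [set F | (F0 `<=` F)%fset]).

Arguments finite_subsets_filter T : clear implicits.

Section Operators.
Context {R : realType} {H : hilbertSpace R}.
Local Notation C := R[i].

(* Operators are plain functions, so that [H -> H] carries the pointwise
   C-vector space structure and the product of operators is [\o]. *)
Local Notation op := (H -> H).

Implicit Types (x y v w : op) (M N D L S : set op).

Definition bounded_operator x : Prop := linear x /\ continuous x.

(* By the Riesz representation theorem every bounded operator has exactly one
   bounded adjoint; the default value 0 is irrelevant on bounded operators. *)
Definition adj x : op :=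
  xget 0 [set y | bounded_operator y /\
                  forall a b : H, hdot (x a) b = hdot a (y b)].

Definition positive_operator x : Prop :=
  bounded_operator x /\ forall a : H, 0 <= hdot (x a) a.

Definition projection x : Prop :=
  [/\ bounded_operator x, adj x = x & x \o x = x].

Definition partial_isometry v : Prop :=
  bounded_operator v /\ projection (adj v \o v).

Definition commutant S : set op :=
  [set x | bounded_operator x /\ forall y, S y -> x \o y = y \o x].

(* Von Neumann algebras are represented on [H]. A commutant is a unital
   algebra of bounded operators, whence so is [M], with unit the identity. *)
Definition von_neumann_algebra M : Prop :=
  (forall x, M x -> M (adj x)) /\ commutant (commutant M) = M.

Definition von_neumann_subalgebra M L : Prop :=
  von_neumann_algebra L /\ L `<=` M.

Definition abelian_operators L : Prop :=
  forall x y, L x -> L y -> x \o y = y \o x.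

Definition relative_commutant M L : set op := M `&` commutant L.

Definition square_summable (a : nat -> H) : Prop :=
  cvgn (series (fun n => `|a n| ^+ 2)).

(* Only the values on [M] of the functionals matter. *)
Definition predual M : set (op -> C) :=
  [set phi | exists a b : nat -> H,
    [/\ square_summable a, square_summable b
      & forall x, M x -> phi x = limn (series (fun n => hdot (x (a n)) (b n)))]].

Definition positive_predual M : set (op -> C) :=
  [set rho | predual M rho /\
             forall x, M x -> positive_operator x -> 0 <= rho x].

Definition weak_star_nbhs M (x : op) : set_system op :=
  seminorm_nbhs M
    [set p | exists2 phi, predual M phi & p = (fun y => `|phi y|)] x.

Definition weak_star_dense M (S : set op) : Prop :=
  forall x, M x -> forall U, weak_star_nbhs M x U -> U `&` S !=set0.

Definition GN M L : set op :=
  [set v | [/\ M v, partial_isometry v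
             & forall d, L d -> L (adj v \o d \o v) /\ L (v \o d \o adj v)]].

Definition regular_subalgebra M L : Prop :=
  weak_star_dense M (linear_span (GN M L)).

(* [E] is a map from M to N: its values outside of M are irrelevant. *)
Record conditional_expectation M N (E : op -> op) : Prop := {
  condexp_in : forall x, M x -> N (E x);
  condexp_linear : forall (c : C) x y, M x -> M y ->
    E (c *: x + y) = c *: E x + E y;
  condexp_pos : forall x, M x -> positive_operator x ->
    positive_operator (E x);
  condexp_id : forall x, N x -> E x = x;
  condexp_bimodule : forall a x b, M x -> N a -> N b ->
    E (a \o x \o b) = a \o E x \o b }.

Definition faithful_map M (E : op -> op) : Prop :=
  forall x, M x -> positive_operator x -> E x = 0 -> x = 0.

Definition normal_map M N (E : op -> op) : Prop :=
  forall x, M x -> E y @[y --> weak_star_nbhs M x] --> weak_star_nbhs N (E x).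

Definition faithful_normal_condexp M N (E : op -> op) : Prop :=
  [/\ conditional_expectation M N E, faithful_map M E & normal_map M N E].

Record cartan_triple M N D : Prop := {
  cartan_vna : von_neumann_algebra M;
  cartan_subN : von_neumann_subalgebra M N;
  cartan_subD : von_neumann_subalgebra M D;
  cartan_abelian : abelian_operators D;
  cartan_regular : regular_subalgebra M D;
  cartan_commutant : N = relative_commutant M D;
  cartan_condexp : exists E, faithful_normal_condexp M N E }.

Definition E_orthogonal (E : op -> op) (Y : set op) : Prop :=
  forall v w, Y v -> Y w -> v <> w -> E (adj v \o w) = 0.

Definition maximal_E_orthogonal M D (E : op -> op) (Y : set op) : Prop :=
  [/\ Y `<=` GN M D, E_orthogonal E Y
    & forall Z : set op, Z `<=` GN M D -> E_orthogonal E Z -> Y `<=` Z ->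
        Z = Y].

Definition bures_nbhs M N (E : op -> op) (x : op) : set_system op :=
  seminorm_nbhs M
    [set p | exists2 rho, positive_predual N rho
                        & p = (fun y => sqrtC (rho (E (adj y \o y))))] x.

Definition partial_expansion (E : op -> op) (Y : set op) (x : op)
    (F : {fset Y}) : op :=
  \sum_(u <- F) (val u \o E (adj (val u) \o x)).

End Operators.

(* Main.v *)
Require Import Defs.
From mathcomp Require Import all_boot all_order all_algebra finmap complex.
From mathcomp Require Import boolp classical_sets filter reals.
From mathcomp Require Import topology normedtype.
From mathcomp Require Import sesquilinear functions sequences ring lra.

(** The expansion [x_F] is a Fourier expansion. For a positive normal
    functional [rho] on [N], the form [(y, z) |-> rho (E (z^* y))] turns [M]
    into a pre-Hilbert space, whose seminorm [|y|_rho] is a Bures seminorm,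
    and [x_F] is the orthogonal projection of [x] on the sum of the pairwise
    orthogonal right [N]-modules [u N] with [u] in [F]. Bessel's inequality
    [|x - x_F|_rho <= |x|_rho] (lemma [bessel]) makes the set of all [x] whose
    expansion converges to [x] closed for [|.|_rho]. It remains to approximate
    every [x] by elements of the span of [GN M D], and to expand the elements
    of [GN M D] themselves.

    Both steps take place in the Hilbert space l2(H) of square-summable
    sequences. Since [E] is normal, [|y|_rho] is small as soon as the l2-norm
    of [y c := (y c_n)_n] is small, for a suitable sequence [c] in l2(H)
    ([normal_dominated]). If [x c] were not in the closure of the vectors
    [y c], [y] in the span of [GN M D], then a vector [d] orthogonal to these
    but not to [x c] would provide the normal functional [y |-> <y c, d>],
    which separates [x] from this span in spite of weak-* density
    ([regular_l2_dense]).

    For [v] in [GN M D], the key fact is that [E v = e v] for some projection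
    [e] of [D] ([condexp_GN]). It follows that [u E (u^* v) = g_u v], where
    the operators [g_u] (called [overlap v u]) with [u] in [Y] are mutually
    orthogonal projections of [D] below [v v^*] ([overlap_orth]). Let [r] be
    the projection on the common kernel of the [g_u]. It lies in [D] because
    [D] is its own bicommutant ([vna_kernel_projection]), so [r v] is in
    [GN M D]; it is moreover [E]-orthogonal to [Y], whence [r v = 0] by
    maximality ([maximal_remainder]). The sums of the [g_u] over finite sets
    thus converge strongly to [v v^*], that is, [v_F c] converges to [v c] in
    l2(H) ([GN_expansion_cvg]). *)

Set Implicit Arguments.
Unset Strict Implicit.
Unset Printing Implicit Defensive.

Import Order.TTheory GRing.Theory Num.Theory Num.Def.
Import numFieldNormedType.Exports.

Local Open Scope classical_set_scope.
Local Open Scope complex_scope.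
Local Open Scope ring_scope.

(** * Semi-inner products and orthogonal projection *)

Section Projection.
Context {R : realType} {V : lmodType R[i]}.
Implicit Types (W A S : set V) (g : V -> V -> R).

Record subspace W : Prop := {
  subspace0 : W 0;
  subspaceD : forall a b, W a -> W b -> W (a + b);
  subspaceZ : forall c a, W a -> W (c *: a) }.

Lemma subspaceN A a : subspace A -> A a -> A (- a).
Proof. by move=> sA Aa; rewrite -scaleN1r; apply: subspaceZ. Qed.

Lemma subspaceB A a b : subspace A -> A a -> A b -> A (a - b).
Proof. by move=> sA Aa Ab; apply: subspaceD => //; apply: subspaceN. Qed.

Lemma subspace_sum A I (r : seq I) (F : I -> V) :
  subspace A -> (forall i, A (F i)) -> A (\sum_(i <- r) F i).
Proof.
move=> sA AF; elim: r => [|i r IH]; first by rewrite big_nil; exact: subspace0.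
by rewrite big_cons; exact: subspaceD.
Qed.

Lemma linear_span_sub S : subspace (linear_span S).
Proof.
split.
- by exists 0, (fun=> 0), (fun=> 0); split=> [[]//|]; rewrite big_ord0.
- move=> _ _ [n [a [s [Ss ->]]]] [m [b [t [St ->]]]].
  exists (n + m)%N,
    (fun i => match fintype.split i with inl j => a j | inr j => b j end),
    (fun i => match fintype.split i with inl j => s j | inr j => t j end).
  split.
    by move=> i; case: (fintype.split i).
  rewrite big_split_ord /=; congr (_ + _); apply: eq_bigr => i _.
    by rewrite -[lshift m i]/(unsplit (inl i)) unsplitK.
  by rewrite -[rshift n i]/(unsplit (inr i)) unsplitK.
- move=> k _ [n [a [s [Ss ->]]]]; exists n, (fun i => k * a i), s; split=> //.
  by rewrite scaler_sumr; apply: eq_bigr => i _; rewrite scalerA.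
Qed.

Lemma linear_span_min S A : subspace A ->
  S `<=` A -> linear_span S `<=` A.
Proof.
move=> sA SA _ [n [a [s [Ss ->]]]].
elim/big_ind : _ => [|x y|i _]; [exact: subspace0|exact: subspaceD|].
by apply: subspaceZ => //; exact: SA.
Qed.

(** The form is real-valued and only real-linear: the real part of a complex
    inner product determines the same norm, the same convergence and, on
    complex subspaces, the same orthogonality, while all estimates stay in
    [R]. It is given on a subspace [W] because square-summability is a
    condition on sequences. *)
Record semi_inner_on W g : Prop := {
  inner_sub : subspace W;
  innerDl : forall a b d, W a -> W b -> W d -> g (a + b) d = g a d + g b d;
  innerZl : forall (t : R) a d, W a -> W d -> g (t%:C *: a) d = t * g a d;
  innerC : forall a b, W a -> W b -> g a b = g b a;
  inner_ge0 : forall a, W a -> 0 <= g a a }.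

Definition inner_complete W g : Prop :=
  forall s : nat -> V, (forall n, W (s n)) ->
    (forall e : R, 0 < e -> exists N, forall m n, (N <= m)%N -> (N <= n)%N ->
       g (s m - s n) (s m - s n) < e) ->
    exists2 l, W l & forall e : R, 0 < e ->
      exists N, forall n, (N <= n)%N -> g (s n - l) (s n - l) < e.

Context {W : set V} {g : V -> V -> R}.
Context (gW : semi_inner_on W g).

Let sW := inner_sub gW.

Lemma innerDr a b d : W a -> W b -> W d -> g d (a + b) = g d a + g d b.
Proof.
move=> Wa Wb Wd; rewrite (innerC gW) ?(innerDl gW)//; last exact: subspaceD.
by rewrite (innerC gW Wa)// (innerC gW Wb).
Qed.

Lemma innerZr t a d : W a -> W d -> g d (t%:C *: a) = t * g d a.
Proof.
move=> Wa Wd; rewrite (innerC gW) ?(innerZl gW)//; last exact: subspaceZ.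
by rewrite (innerC gW Wa).
Qed.

Lemma innerBl a b d : W a -> W b -> W d -> g (a - b) d = g a d - g b d.
Proof.
move=> Wa Wb Wd; have -> : a - b = a + (-1)%:C *: b.
  by rewrite rmorphN rmorph1 scaleN1r.
by rewrite (innerDl gW) ?(innerZl gW) ?mulN1r//; apply: subspaceZ.
Qed.

Lemma innerNN a : W a -> g (- a) (- a) = g a a.
Proof.
move=> Wa; have -> : - a = (-1)%:C *: a by rewrite rmorphN rmorph1 scaleN1r.
rewrite (innerZl gW) ?innerZr//; last exact: subspaceZ.
by rewrite !mulN1r opprK.
Qed.

Lemma inner_sq t a b : W a -> W b ->
  g (a + t%:C *: b) (a + t%:C *: b) = g a a + 2 * t * g a b + t ^+ 2 * g b b.
Proof.
move=> Wa Wb; have Wtb : W (t%:C *: b) by exact: subspaceZ.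
rewrite (innerDl gW) ?innerDr ?(innerZl gW) ?innerZr//; last exact: subspaceD.
by rewrite (innerC gW Wb Wa); ring.
Qed.

Lemma inner_sqD a b : W a -> W b ->
  g (a + b) (a + b) = g a a + 2 * g a b + g b b.
Proof.
by move=> Wa Wb; have := inner_sq 1 Wa Wb; rewrite rmorph1 scale1r => ->; ring.
Qed.

Lemma inner_sqB a b : W a -> W b ->
  g (a - b) (a - b) = g a a - 2 * g a b + g b b.
Proof.
move=> Wa Wb; have := inner_sq (-1) Wa Wb.
by rewrite rmorphN rmorph1 scaleN1r => ->; ring.
Qed.

Lemma inner_sqD_le a b : W a -> W b ->
  g (a + b) (a + b) <= 2 * g a a + 2 * g b b.
Proof.
move=> Wa Wb; have := inner_ge0 gW (subspaceB sW Wa Wb).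
by rewrite inner_sqB// inner_sqD//; lra.
Qed.

(** A near-minimizer [z] of the norm on the line [z + R a] is nearly
    orthogonal to [a], with an explicit rate. With infimum [0] this is a
    Cauchy-Schwarz inequality, weakened so that [g a a = 0] needs no separate
    treatment. *)
Lemma inner_near_min (L e : R) z a : W z -> W a ->
  (forall t : R, L <= g (z + t%:C *: a) (z + t%:C *: a)) -> g z z <= L + e ->
  (g z a) ^+ 2 <= e * (g a a + 1).
Proof.
move=> Wz Wa minL zL.
have a0 := inner_ge0 gW Wa.
have a1 : 0 < g a a + 1 by lra.
pose k := (g a a + 1)^-1.
have k0 : 0 < k by rewrite invr_gt0.
(* the choice [- g z a / g a a] of [t] would be optimal; the denominator is
   shifted to be positive *)
have := minL (- (k * g z a)); rewrite inner_sq// => Lk.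
have kE : k * (g a a + 1) = 1 by rewrite mulVf// gt_eqF.
have : k * (g z a) ^+ 2 <= e.
  have -> : k * g z a ^+ 2 =
      2 * k * g z a ^+ 2 - k * (k * (g a a + 1)) * g z a ^+ 2.
    by rewrite kE; ring.
  have := sqr_ge0 (k * g z a); nra.
by move=> /(ler_wpM2r (ltW a1)); rewrite mulrAC kE mul1r.
Qed.

Lemma inner_CS z a : W z -> W a -> (g z a) ^+ 2 <= g z z * (g a a + 1).
Proof.
move=> Wz Wa; apply: (@inner_near_min 0) => //; last by rewrite add0r.
by move=> t; apply: (inner_ge0 gW); apply: subspaceD => //; apply: subspaceZ.
Qed.

Lemma sq_lt_eq0 (x : R) : (forall e, 0 < e -> x ^+ 2 < e) -> x = 0.
Proof.
move=> xe; apply/eqP; rewrite -[_ == _]sqrf_eq0 eq_le sqr_ge0 andbT.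
by apply/ler_addgt0Pl => e e0; rewrite addr0 ltW// xe.
Qed.

(** Orthogonal projection on the closure of a subspace [A]: by the
    parallelogram law, a sequence in [A] that minimizes the distance to [x] is
    Cauchy; [d] is the difference between [x] and its limit. *)
Lemma orth_proj A x : inner_complete W g -> subspace A -> A `<=` W -> W x ->
  exists2 d, W d & (forall a, A a -> g d a = 0) /\
    forall e, 0 < e -> exists2 y, A y & g (x - d - y) (x - d - y) < e.
Proof.
move=> cW sA AW Wx.
pose S := [set g (x - y) (x - y) | y in A].
have S0 : has_inf S.
  split; first by exists (g (x - 0) (x - 0)), 0 => //; exact: subspace0.
  exists 0 => _ [y Ay <-]; apply: (inner_ge0 gW); apply: subspaceB => //.
  exact: AW.
pose L := inf S.
have Lle y : A y -> L <= g (x - y) (x - y).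
  by move=> Ay; apply: ge_inf; [exact: S0.2|exists y].
have /choice[s sP] n : exists y, A y /\ g (x - y) (x - y) < L + n.+1%:R^-1.
  have n0 : 0 < n.+1%:R^-1 :> R by rewrite invr_gt0 ltr0n.
  have [_ [y Ay <-] yL] := inf_adherent n0 S0.
  by exists y.
have As n := (sP n).1; have Ws n := AW _ (As n).
have Wxs n : W (x - s n) by apply: subspaceB.
have small (e : R) : 0 < e -> exists N, forall n, (N <= n)%N -> n.+1%:R^-1 < e.
  move=> e0; exists (Num.truncn e^-1) => n Nn.
  rewrite invf_plt ?posrE ?ltr0n//; last first.
  by apply: (lt_le_trans (truncnS_gt _)); rewrite ler_nat ltnS.
have [e e0|p Wp sp] := cW s Ws.
  have [N NP] := small (e / 4) ltac:(lra).
  exists N => m n Nm Nn.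
  have := Lle ((2^-1)%:C *: (s m + s n))
    (subspaceZ sA _ (subspaceD sA (As m) (As n))).
  have -> : x - (2^-1)%:C *: (s m + s n) = (2^-1)%:C *: ((x - s m) + (x - s n)).
    rewrite addrACA -opprD scalerBr; congr (_ - _).
    rewrite scalerDr -scalerDl -rmorphD /= (_ : 2^-1 + 2^-1 = 1 :> R).
      by rewrite scale1r.
    by lra.
  have Ws2 := subspaceD sW (Wxs m) (Wxs n).
  rewrite (innerZl gW) ?innerZr//; last exact: subspaceZ.
  have -> : s m - s n = (x - s n) - (x - s m).
    by rewrite opprB [RHS]addrC addrA subrK.
  rewrite inner_sqB// inner_sqD// (innerC gW (Wxs m) (Wxs n)).
  have := (sP m).2; have := (sP n).2; have := NP _ Nm; have := NP _ Nn.
  move: (n.+1%:R^-1) (m.+1%:R^-1) => u v; lra.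
have Wd : W (x - p) by exact: subspaceB.
exists (x - p) => //; split.
  move=> a Aa; have Wa := AW _ Aa.
  apply: sq_lt_eq0 => e e0.
  have a1 : 0 < g a a + 1 by have := inner_ge0 gW Wa; lra.
  have d0 : 0 < e / (4 * (g a a + 1)) by apply: divr_gt0 => //; lra.
  have [N1 N1P] := small _ d0; have [N2 N2P] := sp _ d0.
  pose n := maxn N1 N2.
  have h1 : (g (x - s n) a) ^+ 2 <= n.+1%:R^-1 * (g a a + 1).
    apply: (@inner_near_min L) => //; last exact: ltW (sP n).2.
    move=> t; have -> : x - s n + t%:C *: a = x - (s n - t%:C *: a).
      by rewrite opprB -addrA [- s n + _]addrC.
    by apply: Lle; apply: subspaceB => //; apply: subspaceZ.
  have h2 : (g (s n - p) a) ^+ 2 <= g (s n - p) (s n - p) * (g a a + 1).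
    by apply: inner_CS => //; apply: subspaceB.
  have -> : x - p = (x - s n) + (s n - p) by rewrite addrA subrK.
  rewrite (innerDl gW)//; last exact: subspaceB.
  have h3 := N1P n (leq_maxl _ _); have h4 := N2P n (leq_maxr _ _).
  have dE : e / (4 * (g a a + 1)) * (g a a + 1) = e / 4.
    by field; exact: lt0r_neq0.
  move: h3 h4; rewrite -(ltr_pM2r a1) dE => h3.
  rewrite -(ltr_pM2r a1) dE => h4.
  have := sqr_ge0 (g (x - s n) a - g (s n - p) a).
  by have := le_lt_trans h1 h3; have := le_lt_trans h2 h4; lra.
move=> e e0; have [N NP] := sp _ e0; exists (s N) => //.
have -> : x - (x - p) - s N = - (s N - p).
  by rewrite opprB addrCA subrr addr0 opprB.
rewrite innerNN; last exact: subspaceB.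
exact: NP.
Qed.

(** The component of [x] orthogonal to [A] is orthogonal to [x] too, hence it
    is zero. This plays the role of the Hahn-Banach theorem below. *)
Lemma orth_dense A x : inner_complete W g -> subspace A -> A `<=` W -> W x ->
  (forall d, W d -> (forall a, A a -> g d a = 0) -> g d x = 0) ->
  forall e, 0 < e -> exists2 y, A y & g (x - y) (x - y) < e.
Proof.
move=> cW sA AW Wx dx e e0.
have [d Wd [dA dy]] := orth_proj cW sA AW Wx.
have d0 : g d d = 0.
  apply: sq_lt_eq0 => k k0.
  have d1 : 0 < g d d + 1 by have := inner_ge0 gW Wd; lra.
  have [y Ay yk] := dy _ (divr_gt0 k0 d1).
  have Wy := AW _ Ay; have Wxd : W (x - d) by exact: subspaceB.
  have Wz : W (x - d - y) by exact: subspaceB.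
  have := inner_CS Wz Wd; move: yk; rewrite ltr_pdivlMr// => yk.
  move=> /le_lt_trans /(_ yk).
  rewrite innerBl// innerBl// (innerC gW Wx)// (innerC gW Wy)// dx// (dA y)//.
  by rewrite subr0 sub0r sqrrN.
have [y Ay yk] := dy _ (divr_gt0 e0 (ltr0n _ 2)).
exists y => //.
have Wy := AW _ Ay; have Wxd : W (x - d) by exact: subspaceB.
have -> : x - y = (x - d - y) + d by rewrite addrAC subrK.
apply: le_lt_trans (inner_sqD_le _ Wd) _; first exact: subspaceB.
rewrite d0; move: yk; lra.
Qed.

End Projection.

(** * The underlying real Hilbert space *)

Section HilbertInner.
Context {R : realType} {H : hilbertSpace R}.
Local Notation C := R[i].
Implicit Types (u v w : H).

Definition rdot u v : R := complex.Re (hdot u v).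
Definition sqn u : R := rdot u u.

Lemma hdotC u v : hdot u v = (hdot v u)^*%C.
Proof. by rewrite hermC /= expr0 mul1r. Qed.

Lemma hdotDl u v w : hdot (u + v) w = hdot u w + hdot v w.
Proof. by rewrite linearDl. Qed.

Lemma hdotZl c u w : hdot (c *: u) w = c * hdot u w.
Proof. by rewrite linearZl_LR. Qed.

Lemma hdotDr u v w : hdot w (u + v) = hdot w u + hdot w v.
Proof. by rewrite linearDr. Qed.

Lemma hdotZr c u w : hdot w (c *: u) = c^*%C * hdot w u.
Proof. by rewrite linearZr_LR. Qed.

Lemma hdot0l u : hdot 0 u = 0 :> C. Proof. by rewrite linear0l. Qed.
Lemma hdot0r u : hdot u 0 = 0 :> C. Proof. by rewrite linear0r. Qed.

Lemma hdotBl u v w : hdot (u - v) w = hdot u w - hdot v w.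
Proof. by rewrite linearBl. Qed.
Lemma hdotBr u v w : hdot w (u - v) = hdot w u - hdot w v.
Proof. by rewrite linearBr. Qed.

Lemma hdot_ge0 u : 0 <= hdot u u.
Proof. exact: dnorm_ge0. Qed.

Lemma hdot_sqn u : hdot u u = (sqn u)%:C.
Proof. by rewrite RRe_real// ger0_real// hdot_ge0. Qed.

Lemma sqn_ge0 u : 0 <= sqn u.
Proof. by have := hdot_ge0 u; rewrite hdot_sqn lecE /= eqxx. Qed.

Lemma sqn_eq0 u : sqn u = 0 -> u = 0.
Proof.
move=> u0; have : hdot u u == 0 by rewrite hdot_sqn u0.
by rewrite dnorm_eq0 => /eqP.
Qed.

Lemma norm_sqn u : `|u| ^+ 2 = (sqn u)%:C.
Proof. by rewrite hdot_norm hdot_sqn. Qed.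

Lemma sqn_lt u (e : R) : 0 < e -> (`|u| < e%:C) = (sqn u < e ^+ 2).
Proof.
move=> e0; rewrite -ltcR -norm_sqn rmorphXn /= ltr_pXn2r// nnegrE.
  exact: normr_ge0.
by rewrite lecE /= eqxx ltW.
Qed.

Lemma sqnZ c u : sqn (c *: u) = complex.Re (`|c| ^+ 2) * sqn u.
Proof.
have c2 : (complex.Re (`|c| ^+ 2))%:C = `|c| ^+ 2.
  by rewrite RRe_real// ger0_real// exprn_ge0.
apply/complexI; rewrite -norm_sqn normrZ exprMn norm_sqn.
by rewrite -[in LHS]c2 -rmorphM.
Qed.

Lemma sqnZr (t : R) u : sqn (t%:C *: u) = t ^+ 2 * sqn u.
Proof. by rewrite sqnZ -add_Re2_Im2 /= expr0n /= addr0. Qed.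

Lemma sqn_iZ u : sqn ('i%C *: u) = sqn u.
Proof. by rewrite sqnZ -add_Re2_Im2 /= expr0n /= add0r expr1n mul1r. Qed.

Lemma sqn0 : sqn 0 = 0.
Proof. by rewrite /sqn /rdot hdot0l. Qed.

Lemma inner_H : semi_inner_on [set: H] rdot.
Proof.
split=> //; rewrite /rdot.
- by move=> a b d _ _ _; rewrite hdotDl raddfD.
- move=> t a d _ _; rewrite hdotZl; case: (hdot a d) => x y /=.
  by rewrite mul0r subr0.
- by move=> a b _ _; rewrite hdotC; case: (hdot b a).
- by move=> a _; exact: sqn_ge0.
Qed.

Lemma sqnD_le u v : sqn (u + v) <= 2 * sqn u + 2 * sqn v.
Proof. exact: (inner_sqD_le inner_H). Qed.

Lemma ReM_i (z : C) : complex.Re ('i%C * z) = - complex.Im z.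
Proof. by case: z => x y /=; rewrite mul0r sub0r mul1r. Qed.

Lemma conjc_i : ('i%C : C)^*%C = - 'i%C.
Proof. by apply/eqP; rewrite eq_complex /= oppr0 !eqxx. Qed.

(** The estimate [2 |rdot a b| <= sqn a + sqn b], for [u] and for [i u] in
    place of [a], bounds both parts of [hdot u v]. *)
Lemma hdot_le u v : `|hdot u v| <= (sqn u + sqn v)%:C.
Proof.
have key (a b : H) : 2 * `|rdot a b| <= sqn a + sqn b.
  have h1 := sqn_ge0 (a + b); have h2 := sqn_ge0 (a - b).
  move: h1 h2; rewrite /sqn (inner_sqD inner_H)// (inner_sqB inner_H)//.
  by case: (ger0P (rdot a b)) => _; lra.
have h1 := key u v; have h2 := key ('i%C *: u) v; rewrite sqn_iZ in h2.
apply: le_trans (_ : (`|rdot u v| + `|rdot ('i%C *: u) v|)%:C <= _); last first.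
  by rewrite lecR; lra.
rewrite {2}/rdot hdotZl ReM_i normrN [X in `|X|]complexE.
rewrite (le_trans (ler_normD _ _))// rmorphD /= lerD//.
  by rewrite normc_def /= expr0n /= addr0 sqrtr_sqr.
rewrite normrM normc_def /= expr0n /= add0r expr1n sqrtr1 mul1r.
by rewrite normc_def /= expr0n /= addr0 sqrtr_sqr.
Qed.

Lemma real_complex_gt0 (e : C) : 0 < e -> exists2 r : R, 0 < r & e = r%:C.
Proof.
case: e => x y; rewrite ltcE /= => /andP[/eqP -> x0]; exists x => //.
Qed.

Lemma complete_H : inner_complete [set: H] rdot.
Proof.
move=> s _ cs.
have : cvg (s @ \oo).
  apply/cauchy_cvgP/cauchy_exP => e /real_complex_gt0[r r0 ->].
  have [N NP] := cs (r ^+ 2) (exprn_gt0 _ r0).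
  exists (s N); exists N => // n /= Nn.
  by rewrite -ball_normE /ball_ /= sqn_lt//; apply: NP.
move=> /cvgrPdist_lt sl; exists (lim (s @ \oo)) => // e e0.
have se0 : 0 < Num.sqrt e by rewrite sqrtr_gt0.
have /sl[N _ NP] : 0 < (Num.sqrt e)%:C by rewrite ltcR.
exists N => n Nn; have := NP n Nn.
rewrite distrC sqn_lt// sqr_sqrtr//; exact: ltW.
Qed.

End HilbertInner.

(** * Square-summable sequences *)

Section ComplexSequences.
Context {R : realType}.
Local Notation C := (R[i] : numFieldType).

Lemma cvg_real_complex (u : nat -> R) (l : R) :
  u n @[n --> \oo] --> l -> ((u n)%:C : C) @[n --> \oo] --> (l%:C : C).
Proof.
move=> ul; apply/cvgrPdist_lt => e /real_complex_gt0[r r0 ->].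
move/cvgrPdist_lt: ul => /(_ _ r0); apply: filterS => n.
by rewrite -rmorphB normc_def /= expr0n /= addr0 sqrtr_sqr ltcR.
Qed.

Lemma cvg_Re (u : nat -> C) (l : C) :
  u n @[n --> \oo] --> l ->
  complex.Re (u n) @[n --> \oo] --> complex.Re l.
Proof.
move=> ul; apply/cvgrPdist_lt => e e0.
have e0' : 0 < e%:C :> C by rewrite ltcR.
move/cvgrPdist_lt: ul => /(_ _ e0'); apply: filterS => n.
rewrite -raddfB -ltcR; apply: le_lt_trans; exact: normc_ge_Re.
Qed.

Lemma cvg_complex (u : nat -> C) :
  cvgn (fun n => complex.Re (u n)) -> cvgn (fun n => complex.Im (u n)) ->
  cvgn u.
Proof.
move=> /cvg_real_complex cR /cvg_real_complex cI.
have -> : u =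
    (fun n => (complex.Re (u n))%:C + 'i%C * (complex.Im (u n))%:C : C).
  by apply/funext => n; exact: complexE.
apply/cvg_ex; eexists; apply: cvgD; first exact: cR.
by apply: cvgMr; exact: cI.
Qed.

End ComplexSequences.

Section L2.
Context {R : realType} {H : hilbertSpace R}.
Local Notation C := (R[i] : numFieldType).
Implicit Types (a b c d : nat -> H).

Definition l2 : set (nat -> H) := [set a | cvgn (series (fun n => sqn (a n)))].

Definition l2dot a b : R := limn (series (fun n => rdot (a n) (b n))).

Lemma series_ReE (u : nat -> C) n :
  complex.Re (series u n) = series (fun k => complex.Re (u k)) n.
Proof. by rewrite /series /= raddf_sum. Qed.

Lemma square_summableE a : square_summable a <-> l2 a.
Proof.
have E : series (fun n => `|a n| ^+ 2) =
         (fun n => (series (fun n => sqn (a n)) n)%:C : C).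
  apply/funext => n; rewrite /series /= rmorph_sum.
  by apply: eq_bigr => i _; rewrite norm_sqn.
rewrite /square_summable /l2 /= E; split; last by move=> /cvg_real_complex/cvgP.
by move=> /cvg_Re/cvgP.
Qed.

Lemma sqn_series_nd a :
  nondecreasing_seq (series (fun n => sqn (a n))).
Proof. by apply/nondecreasing_seqP => n; rewrite seriesSr lerDl sqn_ge0. Qed.

Lemma l2_bounded a (B : R) :
  (forall n, series (fun n => sqn (a n)) n <= B) -> l2 a.
Proof.
move=> aB; apply: nondecreasing_is_cvgn; first exact: sqn_series_nd.
by exists B => _ [n _ <-].
Qed.

Lemma l2_series_le a n : l2 a -> series (fun n => sqn (a n)) n <= l2dot a a.
Proof.
by move=> la; apply: nondecreasing_cvgn_le => //; exact: sqn_series_nd.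
Qed.

Lemma l2dot_le a (B : R) :
  (forall n, series (fun n => sqn (a n)) n <= B) -> l2dot a a <= B.
Proof.
move=> aB; apply: limr_le; first exact: l2_bounded aB.
by near=> n; exact: aB.
Unshelve. all: by end_near. Qed.

Lemma l2_sub : subspace l2.
Proof.
split.
- apply: (@l2_bounded _ 0) => n; rewrite /series /= big1// => i _.
  by rewrite /sqn /rdot hdot0l.
- move=> a b la lb.
  apply: (@l2_bounded _ (2 * l2dot a a + 2 * l2dot b b)) => n.
  apply: le_trans (lerD (ler_wpM2l _ (l2_series_le n la))
                        (ler_wpM2l _ (l2_series_le n lb))) => //.
  rewrite /series /= !mulr_sumr -big_split /=.
  by apply: ler_sum => i _; exact: sqnD_le.
- move=> c a la.
  apply: (@l2_bounded _ (complex.Re (`|c| ^+ 2) * l2dot a a)) => n.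
  have c0 : 0 <= complex.Re (`|c| ^+ 2).
    by rewrite -add_Re2_Im2 /=; apply: addr_ge0; exact: sqr_ge0.
  apply: le_trans (ler_wpM2l c0 (l2_series_le n la)).
  rewrite /series /= mulr_sumr.
  by apply: ler_sum => i _; rewrite sqnZ.
Qed.

Lemma cvg_rdot a b : l2 a -> l2 b -> cvgn (series (fun n => rdot (a n) (b n))).
Proof.
move=> la lb; apply: normed_cvg.
apply: (@series_le_cvg _ _ (fun n => sqn (a n) + sqn (b n))).
- by move=> n; exact: normr_ge0.
- by move=> n; apply: addr_ge0; exact: sqn_ge0.
- move=> n; rewrite -lecR; apply: le_trans (hdot_le _ _).
  exact: normc_ge_Re.
- have -> : series (fun n => sqn (a n) + sqn (b n)) =
     series (fun n => sqn (a n)) \+ series (fun n => sqn (b n)).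
    by apply/funext => n; rewrite /series /= big_split.
  exact: is_cvgD.
Qed.

Lemma cvg_hdot a b : l2 a -> l2 b -> cvgn (series (fun n => hdot (a n) (b n))).
Proof.
move=> la lb; apply: cvg_complex.
  rewrite (_ : (fun n => _) = series (fun n => rdot (a n) (b n))).
    exact: cvg_rdot.
  by apply/funext => n; rewrite series_ReE.
have lia : l2 ('i%C *: a) by apply: (subspaceZ l2_sub).
rewrite (_ : (fun n => _) = - series (fun n => rdot (('i%C *: a) n) (b n))).
  by apply: is_cvgN; exact: cvg_rdot.
apply/funext => n; rewrite /series /= fctE /series /= raddf_sum -sumrN.
by apply: eq_bigr => i _; rewrite /rdot hdotZl ReM_i opprK.
Qed.

Lemma Re_lim_hdot a b : l2 a -> l2 b ->
  complex.Re (limn (series (fun n => hdot (a n) (b n)))) = l2dot a b.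
Proof.
move=> la lb; have /cvg_Re := cvg_hdot la lb.
rewrite (_ : (fun n => _) = series (fun n => rdot (a n) (b n))).
  by move=> /cvg_lim <-.
by apply/funext => n; rewrite series_ReE.
Qed.

Lemma inner_l2 : semi_inner_on l2 l2dot.
Proof.
split; first exact: l2_sub.
- move=> a b d la lb ld; rewrite -limD; [|exact: cvg_rdot..].
  congr (limn _); apply/funext => n; rewrite /series /= fctE.
  rewrite -big_split /=; apply: eq_bigr => i _.
  exact: (innerDl inner_H).
- move=> t a d la ld; apply/cvg_lim => //.
  rewrite (_ : series _ = fun n => t * series (fun n => rdot (a n) (d n)) n).
    by apply: cvgMr; exact: cvg_rdot.
  apply/funext => n; rewrite /series /= mulr_sumr.
  by apply: eq_bigr => i _; exact: (innerZl inner_H).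
- move=> a b la lb; congr (limn _); apply/funext => n.
  by rewrite /series /=; apply: eq_bigr => i _; exact: (innerC inner_H).
- move=> a la; apply: le_trans (l2_series_le 0 la).
  by rewrite /series /= big_geq.
Qed.

Lemma sqn_le_l2dot a n : l2 a -> sqn (a n) <= l2dot a a.
Proof.
move=> la; apply: le_trans (l2_series_le n.+1 la).
rewrite seriesSr lerDr /series /=.
by apply: sumr_ge0 => i _; exact: sqn_ge0.
Qed.


(** A Cauchy sequence of l2(H) converges pointwise; the bounds on the partial
    sums of the squared distances pass to the pointwise limit. *)
Lemma complete_l2 : inner_complete l2 l2dot.
Proof.
move=> s ls cs.
have lsB m n : l2 (s m - s n) by apply: (subspaceB l2_sub).
have /choice[l lP] k : exists l : H, forall e : R, 0 < e ->
    exists N, forall n, (N <= n)%N -> sqn (s n k - l) < e.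
  have [//|e e0|l _ lP] := @complete_H R H (fun n => s n k).
    have [N NP] := cs e e0; exists N => m n Nm Nn.
    exact: le_lt_trans (sqn_le_l2dot k (lsB m n)) (NP m n Nm Nn).
  by exists l.
have small K : forall r : R, 0 < r -> exists M, forall m, (M <= m)%N ->
    series (fun k => sqn ((s m - l) k)) K < r.
  elim: K => [|K IH] r r0; first by exists 0 => m _; rewrite /series /= big_geq.
  have r2 : 0 < r / 2 by rewrite divr_gt0.
  have [M MP] := IH _ r2; have [M' MP'] := lP K _ r2.
  exists (maxn M M') => m; rewrite geq_max => /andP[/MP h1 /MP' h2].
  by rewrite seriesSr (splitr r) ltrD.
have close n (e : R) N : (forall m, (N <= m)%N ->
     l2dot (s n - s m) (s n - s m) <= e) -> forall K,
     series (fun k => sqn ((s n - l) k)) K <= 2 * e.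
  move=> ne K; apply/ler_addgt0Pr => h h0.
  have [M MP] := small K _ (divr_gt0 h0 (ltr0n _ 2)).
  have /MP h1 := leq_maxr N M; have /ne h2 := leq_maxl N M.
  have h3 := le_trans (l2_series_le K (lsB n (maxn N M))) h2.
  apply: (@le_trans _ _ (2 * series (fun k => sqn ((s n - s (maxn N M)) k)) K +
     2 * series (fun k => sqn ((s (maxn N M) - l) k)) K)); last first.
    move: h1 h3; move: (series _ _) (series _ _) => u v; lra.
  rewrite /series /= !mulr_sumr -big_split /=; apply: ler_sum => i _.
  have -> : (s n - l) i = (s n - s (maxn N M)) i + (s (maxn N M) - l) i.
    by rewrite !fctE addrA subrK.
  exact: sqnD_le.
have ll : l2 l.
  have [N NP] := cs 1 ltr01.
  have := close N 1 N (fun m Nm => ltW (NP _ _ (leqnn _) Nm)).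
  move=> /l2_bounded => lb.
  have -> : l = s N - (s N - l) by rewrite opprB addrC subrK.
  exact: (subspaceB l2_sub).
exists l => // e e0; have e4 : 0 < e / 4 by rewrite divr_gt0.
have [N NP] := cs _ e4; exists N => n Nn.
have := close n _ N (fun m Nm => ltW (NP _ _ Nn Nm)).
by move=> /l2dot_le /le_lt_trans; apply; lra.
Qed.

End L2.

(** * Riesz representation and adjoints *)

Section Adjoint.
Context {R : realType} {H : hilbertSpace R}.
Local Notation C := R[i].
Local Notation op := (H -> H).
Implicit Types (x y : op) (a b : H).

(** A complex subspace contains [i a] along with [a], and [rdot d (i a)] is
    the imaginary part of [hdot d a]. *)
Lemma rdot_orth (A : set H) (d : H) : subspace A ->
  (forall a, A a -> rdot d a = 0) -> forall a, A a -> hdot d a = 0 :> C.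
Proof.
move=> sA dA a Aa; apply/eqP; rewrite eq_complex; apply/andP; split.
  by apply/eqP; exact: dA.
have := dA _ (subspaceZ sA 'i%C Aa); rewrite /rdot hdotZr.
by case: (hdot d a) => u v /=; rewrite mul0r sub0r mulN1r opprK => ->.
Qed.

Lemma hdot_inj a b : (forall d, hdot d a = hdot d b) -> a = b.
Proof.
move=> ab; apply/subr0_eq/sqn_eq0; apply: (@complexI R).
by rewrite -hdot_sqn hdotBr ab subrr.
Qed.

Lemma linear0_op x : linear x -> x 0 = 0.
Proof.
by move=> lx; have := lx (-1) 0 0; rewrite scaler0 addr0 scaleN1r addNr.
Qed.

Lemma linearZ_op x c a : linear x -> x (c *: a) = c *: x a.
Proof. by move=> lx; have := lx c a 0; rewrite (linear0_op lx) !addr0. Qed.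

Lemma linearD_op x a b : linear x -> x (a + b) = x a + x b.
Proof. by move=> lx; have := lx 1 a b; rewrite !scale1r. Qed.

Lemma linearN_op x a : linear x -> x (- a) = - x a.
Proof. by move=> lx; rewrite -scaleN1r linearZ_op// scaleN1r. Qed.

Lemma linearB_op x a b : linear x -> x (a - b) = x a - x b.
Proof. by move=> lx; rewrite linearD_op// linearN_op. Qed.

Lemma homogeneous_bound x (d B : R) : linear x -> 0 < d ->
  (forall a, sqn a <= d -> sqn (x a) <= B) ->
  forall a, sqn (x a) <= B / d * sqn a.
Proof.
move=> lx d0 xB a; have := sqn_ge0 a; rewrite le_eqVlt => /predU1P[a0|a0].
  by rewrite -a0 (sqn_eq0 (esym a0)) linear0_op// sqn0 mulr0.
pose t := Num.sqrt (d / sqn a).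
have t2 : t ^+ 2 = d / sqn a by rewrite sqr_sqrtr// ltW// divr_gt0.
have := xB (t%:C *: a); rewrite linearZ_op// !sqnZr t2 divfK ?gt_eqF//.
move=> /(_ (lexx _)) h.
have -> : B / d * sqn a = B * (d / sqn a)^-1 by rewrite invf_div mulrA mulrAC.
by rewrite ler_pdivlMr ?divr_gt0// mulrC.
Qed.

Lemma bounded_operatorP x : bounded_operator x <->
  linear x /\ exists K : R, forall a, sqn (x a) <= K * sqn a.
Proof.
split=> [[lx cx]|[lx [K xK]]]; split=> //.
  have /cvgrPdist_lt/(_ 1 ltr01) := cx 0.
  rewrite linear0_op// => /nbhs_ballP[d /= /real_complex_gt0[r r0 ->] rx].
  exists (1 / (r / 2) ^+ 2); apply: homogeneous_bound => //.
    by rewrite exprn_gt0// divr_gt0.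
  move=> a ar; have h : `|a| < r%:C -> `|x a| < 1%:C.
    by have := rx a; rewrite -ball_normE /ball_ /= !sub0r !normrN.
  move: h; rewrite !sqn_lt// expr1n => h; apply/ltW/h; apply: le_lt_trans ar _.
  by rewrite ltr_pXn2r ?nnegrE ?ltW ?divr_gt0//; lra.
have K0 : 0 <= `|K| by [].
have xK' a : sqn (x a) <= `|K| * sqn a.
  by apply: le_trans (xK a) _; rewrite ler_wpM2r ?sqn_ge0 ?ler_norm.
move=> a; apply/cvgrPdist_lt => e /real_complex_gt0[r r0 ->].
have k0 : 0 < `|K| + 1 by lra.
pose d := r / (`|K| + 1).
have d0 : 0 < d by rewrite divr_gt0.
apply/nbhs_ballP; exists d%:C => /=; first by rewrite ltcR.
move=> b; rewrite -ball_normE /ball_ /= sqn_lt// => ab.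
rewrite -linearB_op// sqn_lt//.
apply: le_lt_trans (xK' _) _.
have -> : r ^+ 2 = (`|K| + 1) ^+ 2 * d ^+ 2.
  by rewrite -exprMn mulrC divfK// gt_eqF.
apply: le_lt_trans (_ : (`|K| + 1) ^+ 2 * sqn (a - b) < _); last first.
  by rewrite ltr_pM2l// exprn_gt0.
by rewrite ler_wpM2r ?sqn_ge0//; nra.
Qed.

(** The representing vector spans the orthogonal complement of the kernel. The
    bound on the real part is enough, since [Im (f a) = - Re (f (i a))]. *)
Lemma riesz (f : H -> C) (K : R) :
  (forall c a b, f (c *: a + b) = c * f a + f b) ->
  (forall a, complex.Re (f a) ^+ 2 <= K * sqn a) ->
  exists d, forall a, f a = hdot a d.
Proof.
move=> lf fK.
have f0 : f 0 = 0.
  by have := lf (-1) 0 0; rewrite scaler0 addr0 mulN1r addNr.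
have fZ c a : f (c *: a) = c * f a by rewrite -[c *: a]addr0 lf f0 addr0.
have fD a b : f (a + b) = f a + f b.
  by rewrite -[a in LHS]scale1r lf mul1r.
have fB a b : f (a - b) = f a - f b by rewrite fD -scaleN1r fZ mulN1r.
have [[h fh]|nf] := pselect (exists h, f h <> 0); last first.
  exists 0 => a; rewrite hdot0r.
  by apply: contrapT => fa; apply: nf; exists a.
pose A := [set a | f a = 0].
have sA : subspace A.
  split=> //= [a b fa fb|c a fa]; first by rewrite /A /= fD fa fb addr0.
  by rewrite /A /= fZ fa mulr0.
have [d _ [dA dy]] := orth_proj inner_H complete_H sA (@subsetT _ _)
  (I : [set: H] h).
have fdh : f d = f h.
  apply/esym/subr0_eq; rewrite -fB.
  have close e : 0 < e -> exists2 z, f z = f (h - d) & sqn z < e.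
    move=> /dy[y /= fy ye]; exists (h - d - y) => //.
    by rewrite (fB (h - d)) fy subr0.
  have K1 : 0 < `|K| + 1 by have := normr_ge0 K; lra.
  have fK' a : complex.Re (f a) ^+ 2 <= (`|K| + 1) * sqn a.
    apply: le_trans (fK a) _; rewrite ler_wpM2r ?sqn_ge0//.
    by have := ler_norm K; lra.
  apply/eqP; rewrite eq_complex; apply/andP; split; apply/eqP/sq_lt_eq0 => e e0.
    have [z <-] := close _ (divr_gt0 e0 K1); rewrite ltr_pdivlMr// => zh.
    by apply: le_lt_trans (fK' z) _; rewrite mulrC.
  have [z <-] := close _ (divr_gt0 e0 K1); rewrite ltr_pdivlMr// => zh.
  have := fK' ('i%C *: z); rewrite fZ ReM_i sqrrN sqn_iZ => /le_lt_trans; apply.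
  by rewrite mulrC.
have fd : f d != 0 by rewrite fdh; apply/eqP.
have sd : (sqn d)%:C != 0.
  apply/eqP => /(@complexI R)/sqn_eq0 d0; move: fd; rewrite d0 f0 eqxx//.
have orth a : f a = 0 -> hdot a d = 0.
  by move=> fa; rewrite hdotC (rdot_orth sA dA)// conjc0.
exists ((f d / (sqn d)%:C)^*%C *: d) => a.
have /orth : f (a - (f a / f d) *: d) = 0 by rewrite fB fZ divfK ?subrr.
rewrite hdotBl hdotZl hdotZr conjcK => /subr0_eq ->.
by rewrite hdot_sqn; field; rewrite fd.
Qed.

Lemma adjoint_ex x : bounded_operator x -> exists y, bounded_operator y /\
  forall a b : H, hdot (x a) b = hdot a (y b).
Proof.
move=> /bounded_operatorP[lx [K xK]].
have /choice[y xy] b : exists d, forall a, hdot (x a) b = hdot a d.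
  apply: (@riesz _ (K * (sqn b + 1))).
    by move=> c a a'; rewrite lx hdotDl hdotZl.
  move=> a; apply: le_trans (inner_CS inner_H _ _) _ => //.
  have : 0 <= sqn b + 1 by have := sqn_ge0 b; lra.
  by move=> /ler_wpM2r/(_ _ _ (xK a)); rewrite mulrAC.
have ly : linear y.
  move=> c a b; apply: hdot_inj => d.
  by rewrite -xy !hdotDr !hdotZr !xy.
exists y; split; last by move=> a b; rewrite xy.
apply/bounded_operatorP; split=> //.
exists (2 * `|K| / 1); apply: homogeneous_bound => // b b1.
(* [|y b|^2 = <x y b, b>] is at most a multiple of [|y b|] on the unit ball *)
have Ky : sqn (x (y b)) <= `|K| * sqn (y b).
  by apply: le_trans (xK _) _; rewrite ler_wpM2r ?sqn_ge0 ?ler_norm.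
have yE : rdot (x (y b)) b = sqn (y b) by rewrite /rdot xy hdot_sqn.
have := inner_CS inner_H (I : [set: H] (x (y b))) (I : [set: H] b).
rewrite yE -/(sqn _) -/(sqn _); have := sqn_ge0 (y b); have := sqn_ge0 b.
have := normr_ge0 K.
move: Ky b1; move: (sqn _) (sqn _) (sqn _) `|K| => u v w k h1 h2 h3 h4 h5 h6.
have h7 : v ^+ 2 <= 2 * k * v by nra.
have [v0|v0] := ltP 0 v; last by nra.
by move: h7; rewrite expr2 ler_pM2r.
Qed.

Lemma adjP x : bounded_operator x -> bounded_operator (adj x) /\
  forall a b : H, hdot (x a) b = hdot a (adj x b).
Proof. by move=> /adjoint_ex; exact: xgetPex. Qed.

End Adjoint.

(** * Operators, projections and von Neumann algebras *)

Section OperatorAlgebra.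
Context {R : realType} {H : hilbertSpace R}.
Local Notation C := R[i].
Local Notation op := (H -> H).
Implicit Types (x y z v w e : op) (M N D L S : set op).

Lemma bounded_linear x : bounded_operator x -> linear x.
Proof. by case. Qed.

Lemma bounded_id : bounded_operator (@idfun H : op).
Proof. by split=> // a; exact: cvg_id. Qed.

Lemma bounded_comp x y : bounded_operator x -> bounded_operator y ->
  bounded_operator (x \o y).
Proof.
move=> [lx cx] [ly cy]; split=> [c a b|a] /=; first by rewrite ly lx.
by apply: continuous_comp; [exact: cy|exact: cx].
Qed.

Lemma bounded_subspace : subspace (@bounded_operator R H).
Proof.
split=> [|x y [lx cx] [ly cy]|c x [lx cx]].
- by split=> [c a b|a]; [rewrite scaler0 addr0|exact: cvg_cst].
- split=> [c a b|a]; last by apply: cvgD; [exact: cx|exact: cy].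
  by rewrite !fctE lx ly scalerDr addrACA.
- split=> [k a b|a]; last by apply: cvgZr; exact: cx.
  by rewrite !fctE lx scalerDr !scalerA mulrC.
Qed.

Lemma adj_bounded x : bounded_operator x -> bounded_operator (adj x).
Proof. by case/adjP. Qed.

Lemma hdot_adjr x a b : bounded_operator x ->
  hdot (x a) b = hdot a (adj x b) :> C.
Proof. by case/adjP. Qed.

Lemma hdot_adjl x a b : bounded_operator x ->
  hdot (adj x a) b = hdot a (x b) :> C.
Proof. by move=> bx; rewrite hdotC -hdot_adjr// -hdotC. Qed.

Lemma adj_eq x y : bounded_operator x ->
  (forall a b : H, hdot (x a) b = hdot a (y b)) -> adj x = y.
Proof.
move=> bx xy; apply/funext => b; apply: hdot_inj => a.
by rewrite -hdot_adjr.
Qed.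

Lemma adjK x : bounded_operator x -> adj (adj x) = x.
Proof.
move=> bx; apply: adj_eq; first exact: adj_bounded.
by move=> a b; exact: hdot_adjl.
Qed.

Lemma adj_comp x y : bounded_operator x -> bounded_operator y ->
  adj (x \o y) = adj y \o adj x.
Proof.
move=> bx bY; apply: adj_eq => [|a b /=]; first exact: bounded_comp.
by rewrite !hdot_adjr.
Qed.

Lemma adjD x y : bounded_operator x -> bounded_operator y ->
  adj (x + y) = adj x + adj y.
Proof.
move=> bx bY; apply: adj_eq => [|a b /=].
  exact: (subspaceD bounded_subspace).
by rewrite !fctE hdotDl hdotDr !hdot_adjr.
Qed.

Lemma adjZ c x : bounded_operator x -> adj (c *: x) = c^*%C *: adj x.
Proof.
move=> bx; apply: adj_eq => [|a b /=].
  exact: (subspaceZ bounded_subspace).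
by rewrite !fctE hdotZl hdotZr conjcK hdot_adjr.
Qed.

Lemma adj0 : adj (0 : op) = 0.
Proof.
apply: adj_eq => [|a b]; first exact: (subspace0 bounded_subspace).
by rewrite hdot0l hdot0r.
Qed.

Lemma adj_id : adj (@idfun H : op) = idfun.
Proof. by apply: adj_eq => //; exact: bounded_id. Qed.

Lemma adjN x : bounded_operator x -> adj (- x) = - adj x.
Proof. by move=> bx; rewrite -scaleN1r adjZ// rmorphN1 scaleN1r. Qed.

Lemma adjB x y : bounded_operator x -> bounded_operator y ->
  adj (x - y) = adj x - adj y.
Proof.
move=> bx bY; rewrite adjD// ?adjN//.
exact: (subspaceN bounded_subspace).
Qed.

Lemma compDr x y z : linear x -> x \o (y + z) = (x \o y) + (x \o z).
Proof. by move=> lx; apply/funext => a; exact: (linearD_op (y a) (z a) lx). Qed.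

Lemma compBr x y z : linear x -> x \o (y - z) = (x \o y) - (x \o z).
Proof. by move=> lx; apply/funext => a; exact: (linearB_op (y a) (z a) lx). Qed.

Lemma compZr x c y : linear x -> x \o (c *: y) = c *: (x \o y).
Proof. by move=> lx; apply/funext => a; exact: (linearZ_op c (y a) lx). Qed.

Lemma comp0r x : linear x -> x \o (0 : op) = 0.
Proof. by move=> lx; apply/funext => a; exact: (linear0_op lx). Qed.

Lemma comp_sumr I (r : seq I) x (F : I -> op) : linear x ->
  x \o (\sum_(i <- r) F i) = \sum_(i <- r) (x \o F i).
Proof.
move=> lx; elim: r => [|i r IH]; first by rewrite !big_nil comp0r.
by rewrite !big_cons compDr// IH.
Qed.

Lemma comp_suml I (r : seq I) x (F : I -> op) :
  (\sum_(i <- r) F i) \o x = \sum_(i <- r) (F i \o x).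
Proof.
elim: r => [|i r IH]; first by rewrite !big_nil.
by rewrite !big_cons -IH.
Qed.

Lemma adj_comp_positive x :
  bounded_operator x -> positive_operator (adj x \o x).
Proof.
move=> bx; split; first exact/bounded_comp/bx/adj_bounded.
by move=> a /=; rewrite hdot_adjl// hdot_ge0.
Qed.

(** Polarization: the form [<x c, d> - <c, x d>] vanishes on the diagonal. *)
Lemma positive_self_adjoint x : positive_operator x -> adj x = x.
Proof.
move=> [bx px]; apply: adj_eq => // a b; have lx := bounded_linear bx.
pose f (c d : H) : C := hdot (x c) d - hdot c (x d).
have fcc (c : H) : f c c = 0.
  rewrite /f [X in _ - X]hdotC.
  by apply/eqP; rewrite subr_eq0 eq_sym; apply/eqP/CrealP/ger0_real.
have fD (c d : H) : f c d + f d c = 0.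
  have := fcc (c + d); rewrite /f linearD_op// !hdotDl !hdotDr.
  have := fcc c; have := fcc d; rewrite /f => /subr0_eq -> /subr0_eq -> h.
  by rewrite -[RHS]h; ring.
have := fD a b; have := fD a ('i%C *: b); rewrite /f.
rewrite (linearZ_op _ _ lx) !hdotZl !hdotZr => h1 h2.
have ii : 'i%C * 'i%C = -1 :> C by rewrite -expr2 sqr_i.
rewrite conjc_i in h1.
have : 2 * (hdot (x a) b - hdot a (x b)) = 0.
  transitivity ((hdot (x a) b - hdot a (x b) + (hdot (x b) a - hdot b (x a))) +
    'i%C * (- 'i%C * hdot (x a) b - - 'i%C * hdot a (x b) +
       ('i%C * hdot (x b) a - 'i%C * hdot b (x a)))); last first.
    by rewrite h2 h1 mulr0 addr0.
  rewrite !mulrDr !mulrN !mulNr !mulrN !mulrA ii; ring.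
by move/eqP; rewrite mulf_eq0 pnatr_eq0 /= => /eqP/subr0_eq.
Qed.

(** The algebraic part of being a von Neumann algebra. *)
Record star_algebra M : Prop := {
  staralg_bounded : forall x, M x -> bounded_operator x;
  staralg_sub : subspace M;
  staralg_id : M idfun;
  staralg_comp : forall x y, M x -> M y -> M (x \o y);
  staralg_adj : forall x, M x -> M (adj x) }.

Lemma commutant_star_algebra S : (forall x, S x -> bounded_operator x) ->
  (forall x, S x -> S (adj x)) -> star_algebra (commutant S).
Proof.
move=> bS aS; split.
- by move=> ? [].
- split.
  + split; first exact: (subspace0 bounded_subspace).
    by move=> y Sy; rewrite comp0r//; exact: (bounded_linear (bS _ Sy)).
  + move=> x y [bx cx] [bY cy]; split.
      exact: (subspaceD bounded_subspace).
    move=> z Sz; rewrite (compDr _ _ (bounded_linear (bS _ Sz))).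
    by rewrite -cx// -cy.
  + move=> c x [bx cx]; split; first exact: (subspaceZ bounded_subspace).
    by move=> z Sz; rewrite (compZr _ _ (bounded_linear (bS _ Sz))) -cx.
- by split=> //; exact: bounded_id.
- move=> x y [bx cx] [bY cy]; split; first exact: bounded_comp.
  move=> z Sz; rewrite -[LHS]/(x \o (y \o z)) cy//.
  by rewrite -[LHS]/((x \o z) \o y) cx.
- move=> x [bx cx]; split; first exact: adj_bounded.
  move=> y Sy; have bY := bS _ Sy; have bay := adj_bounded bY.
  have : adj (x \o adj y) = adj (adj y \o x) by rewrite cx//; exact: aS.
  by rewrite (adj_comp bx bay) (adj_comp bay bx) (adjK bY).
Qed.

Lemma vna_bounded M x : von_neumann_algebra M -> M x -> bounded_operator x.
Proof. by move=> [_ <-] []. Qed.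

Lemma vna_commutant_star_algebra M : von_neumann_algebra M ->
  star_algebra (commutant M).
Proof.
move=> vM; apply: commutant_star_algebra => x; first exact: vna_bounded.
exact: vM.1.
Qed.

Lemma vna_star_algebra M : von_neumann_algebra M -> star_algebra M.
Proof.
move=> vM; have sM := vna_commutant_star_algebra vM.
rewrite -vM.2; apply: commutant_star_algebra => x.
  exact: staralg_bounded.
exact: staralg_adj.
Qed.

Lemma kernel_decomposition L (h : H) : (forall l, L l -> bounded_operator l) ->
  exists k, (forall l, L l -> l k = 0) /\
    forall k', (forall l, L l -> l k' = 0) -> hdot (h - k) k' = 0 :> C.
Proof.
move=> bL; pose A := [set k : H | forall l, L l -> l k = 0].
have sA : subspace A.
  split.
  - by move=> l /bL/bounded_linear/linear0_op.
  - move=> a b Aa Ab l Ll; rewrite (linearD_op _ _ (bounded_linear (bL _ Ll))).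
    by rewrite Aa// Ab// addr0.
  - move=> c a Aa l Ll; rewrite (linearZ_op _ _ (bounded_linear (bL _ Ll))).
    by rewrite Aa// scaler0.
have [d _ [dA dy]] := orth_proj inner_H complete_H sA (@subsetT _ _)
  (I : [set: H] h).
exists (h - d); split; last first.
  by move=> k' Ak'; rewrite opprB addrC subrK; exact: (rdot_orth sA).
move=> l Ll; have /bounded_operatorP[ll [K lK]] := bL _ Ll.
have K1 : 0 < `|K| + 1 by have := normr_ge0 K; lra.
apply/sqn_eq0/eqP; rewrite eq_le sqn_ge0 andbT; apply/ler_addgt0Pl => e e0.
have [y Ay] := dy _ (divr_gt0 e0 K1); rewrite ltr_pdivlMr// addr0 => ye.
have -> : l (h - d) = l (h - d - y).
  by rewrite (linearB_op (h - d) _ ll) Ay// subr0.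
apply: le_trans (lK _) _; apply: le_trans (ltW ye); rewrite mulrC.
by rewrite ler_wpM2l ?sqn_ge0//; have := ler_norm K; lra.
Qed.

(** The common kernel of a family of bounded operators is a closed subspace;
    [e] is the orthogonal projection on it. *)
Lemma kernel_projection L : (forall l, L l -> bounded_operator l) ->
  exists e, [/\ projection e, (forall l, L l -> l \o e = 0) &
    forall a, (forall l, L l -> l a = 0) -> e a = a].
Proof.
move=> bL; have ll l (Ll : L l) := bounded_linear (bL _ Ll).
have /choice[e eP] := fun h => kernel_decomposition h bL.
have eL l a : L l -> l (e a) = 0 by move=> Ll; exact: (eP a).1.
have uniq h k : (forall l, L l -> l k = 0) ->
    (forall k', (forall l, L l -> l k' = 0) -> hdot (h - k) k' = 0 :> C) ->
    e h = k.
  move=> kL hk; apply/subr0_eq/sqn_eq0/(@complexI R); rewrite -hdot_sqn.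
  have zL l : L l -> l (e h - k) = 0.
    by move=> Ll; rewrite (linearB_op _ _ (ll _ Ll)) eL// kL// subrr.
  have -> : e h - k = (h - k) - (h - e h).
    by rewrite opprB [RHS]addrC addrA subrK.
  rewrite {1}hdotBl.
  have -> : (h - k) - (h - e h) = e h - k.
    by rewrite opprB [LHS]addrC addrA subrK.
  by rewrite hk// (eP h).2// subrr.
have le : linear e.
  move=> c a b; apply: uniq => [l Ll|k' Lk'].
    by rewrite (ll _ Ll) !eL// scaler0 addr0.
  have -> : c *: a + b - (c *: e a + e b) = c *: (a - e a) + (b - e b).
    by rewrite scalerBr opprD addrACA.
  by rewrite hdotDl hdotZl !(eP _).2// mulr0 addr0.
have ea a : hdot (a - e a) (e a) = 0 :> C.
  by apply: (eP a).2 => l Ll; exact: eL.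
have be : bounded_operator e.
  apply/bounded_operatorP; split=> //; exists 1 => a; rewrite mul1r.
  have -> : sqn a = sqn ((a - e a) + e a) by rewrite subrK.
  have ra : rdot (a - e a) (e a) = 0 by rewrite /rdot ea.
  rewrite /sqn (inner_sqD inner_H)// ra mulr0 addr0.
  by rewrite lerDr; exact: sqn_ge0.
have sae : adj e = e.
  apply: adj_eq => // a b.
  have -> : hdot (e a) b = hdot (e a) (e b).
    rewrite -[b in LHS](subrK (e b)) hdotDr [X in X + _]hdotC.
    by rewrite (eP b).2 ?conjc0 ?add0r// => l Ll; exact: eL.
  rewrite -[a in RHS](subrK (e a)) hdotDl (eP a).2 ?add0r// => l Ll.
  exact: eL.
have eid a : (forall l, L l -> l a = 0) -> e a = a.
  by move=> La; apply: uniq => // k' _; rewrite subrr hdot0l.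
exists e; split => //.
  split=> //; apply/funext => a /=; apply: eid => l Ll; exact: eL.
by move=> l Ll; apply/funext => a /=; exact: eL.
Qed.

(** Operators of [D'] commute with [L], so they and their adjoints leave the
    common kernel of [L] invariant: the projection on it commutes with [D'],
    that is, belongs to [D'' = D]. *)
Lemma vna_kernel_projection D L : von_neumann_algebra D -> L `<=` D ->
  exists e, [/\ D e, projection e, (forall l, L l -> l \o e = 0) &
    forall a, (forall l, L l -> l a = 0) -> e a = a].
Proof.
move=> vD LD.
have [|e [pe Le eid]] := @kernel_projection L.
  by move=> l /LD; exact: vna_bounded.
exists e; split => //; have [be sae ee] := pe.
have sD' := vna_commutant_star_algebra vD.
have ete t : commutant D t -> e \o t \o e = t \o e.
  move=> Dt; apply/funext => a /=; apply: eid => l Ll.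
  rewrite -[LHS]/((l \o t) (e a)) -(Dt.2 l (LD _ Ll)) /=.
  have -> : l (e a) = 0 by rewrite -[LHS]/((l \o e) a) Le.
  by apply: linear0_op; exact: (bounded_linear Dt.1).
rewrite -vD.2; split=> // t Dt.
have bt := Dt.1; have bat := adj_bounded bt.
have := congr1 (@adj R H) (ete _ (staralg_adj sD' Dt)).
rewrite (adj_comp (bounded_comp be bat) be) (adj_comp be bat) (adj_comp bat be).
rewrite (adjK bt) sae => h.
by rewrite -h; exact: ete.
Qed.

(** For [p := v^* v] one has
    [|v a - v p a|^2 = <p (a - p a), a - p a> = 0]. *)
Lemma pi_vvv v : partial_isometry v -> v \o adj v \o v = v.
Proof.
move=> [bv [bp sp pp]]; apply/funext => a /=; apply/esym/subr0_eq/sqn_eq0.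
have lv := bounded_linear bv.
rewrite -(linearB_op _ _ lv); apply: (@complexI R); rewrite -hdot_sqn.
rewrite hdot_adjr// !(linearB_op _ _ lv).
rewrite (linearB_op _ _ (bounded_linear (adj_bounded bv))).
have -> : adj v (v (adj v (v a))) = adj v (v a).
  by have := congr1 (@^~ a) pp.
by rewrite subrr hdot0r.
Qed.



Lemma projection_complement_contract e (h : H) : projection e ->
  sqn (h - e h) <= sqn h.
Proof.
move=> [be sae ee].
have r0 : rdot (h - e h) (e h) = 0.
  rewrite /rdot -[in X in hdot _ X]sae -(hdot_adjr _ _ be).
  rewrite (linearB_op _ _ (bounded_linear be)) -[e (e h)]/((e \o e) h) ee.
  by rewrite subrr hdot0l.
have -> : sqn h = sqn ((h - e h) + e h) by rewrite subrK.
rewrite /sqn [leRHS](inner_sqD inner_H)// r0 mulr0 addr0.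
by rewrite lerDl; exact: sqn_ge0.
Qed.

Lemma l2_image x (c : nat -> H) : bounded_operator x -> l2 c ->
  l2 (fun n => x (c n)).
Proof.
move=> /bounded_operatorP[_ [K xK]] lc.
apply: (@l2_bounded _ _ _ (`|K| * l2dot c c)) => n.
apply: le_trans (ler_wpM2l (normr_ge0 K) (l2_series_le n lc)).
rewrite /series /= mulr_sumr; apply: ler_sum => i _.
by apply: le_trans (xK _) _; rewrite ler_wpM2r ?sqn_ge0 ?ler_norm.
Qed.

Definition single (n : nat) (k : H) : nat -> H :=
  fun m => if m == n then k else 0.

Lemma series_single (V : zmodType) (f : nat -> H -> V) n (k : H) m :
  (forall i, f i 0 = 0) -> (n < m)%N ->
  series (fun i => f i (single n k i)) m = f n k.
Proof.
move=> f0 nm; rewrite /series /= big_mkord (bigD1 (Ordinal nm))//= /single eqxx.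
rewrite big1 ?addr0// => i; rewrite -val_eqE /= => /negbTE ->; exact: f0.
Qed.

Lemma l2_single n (k : H) : l2 (single n k).
Proof.
apply: (@l2_bounded _ _ _ (sqn k)) => m.
apply: le_trans (sqn_series_nd (single n k) (leq_maxl m n.+1)) _.
by rewrite (@series_single _ (fun=> sqn)) ?leq_maxr// => _; exact: sqn0.
Qed.

Lemma l2dot_single (d : nat -> H) n (k : H) :
  l2dot d (single n k) = rdot (d n) k.
Proof.
apply: lim_near_cst => //; exists n.+1 => // m /= nm.
rewrite (@series_single _ (fun i => rdot (d i)))// => i.
by rewrite /rdot hdot0r.
Qed.


Definition interleave (a b : nat -> H) : nat -> H :=
  fun n => if odd n then b n./2 else a n./2.

Lemma series_interleave (a b : nat -> H) (f : H -> R) n :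
  series (fun k => f (interleave a b k)) n.*2 =
  series (fun k => f (a k)) n + series (fun k => f (b k)) n.
Proof.
elim: n => [|n IH]; first by rewrite /series /= !big_geq// addr0.
rewrite doubleS !seriesSr IH /interleave /= odd_double /= uphalf_double.
by rewrite doubleK addrACA addrA.
Qed.

Lemma l2_interleave a b : l2 a -> l2 b -> l2 (interleave a b).
Proof.
move=> la lb; apply: (@l2_bounded _ _ _ (l2dot a a + l2dot b b)) => n.
apply: le_trans (sqn_series_nd (interleave a b) (_ : n <= n.*2)%O) _.
  by rewrite leEnat -addnn leq_addr.
by rewrite (series_interleave a b sqn) lerD ?l2_series_le.
Qed.

(** Interleaving makes finitely many square-summable sequences subsequences of
    a single one, which controls finitely many normal functionals at once. *)
Lemma l2_merge n (a : 'I_n -> nat -> H) : (forall i, l2 (a i)) ->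
  exists2 c, l2 c & forall (f : H -> R) (B : R), (forall h, 0 <= f h) ->
    (forall k, series (fun m => f (c m)) k <= B) ->
    forall i k, series (fun m => f (a i m)) k <= B.
Proof.
elim: n a => [|n IH] a la.
  by exists 0 => [|f B f0 fB []//]; exact: (subspace0 l2_sub).
have [c lc cP] := IH (fun i => a (lift ord0 i)) (fun i => la _).
exists (interleave (a ord0) c) => [|f B f0 fB i]; first exact: l2_interleave.
have s0 (d : nat -> H) k : 0 <= series (fun m => f (d m)) k.
  by apply: sumr_ge0 => m _.
have [j ->|-> k] := unliftP ord0 i.
  apply: cP => // k; apply: le_trans (fB k.*2).
  by rewrite series_interleave lerDr.
by apply: le_trans (fB k.*2); rewrite series_interleave lerDl.
Qed.

Lemma norm_lim_hdot_lt (a b : nat -> H) (e : R) : l2 a -> l2 b -> 0 < e ->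
  (forall n, series (fun k => sqn (a k)) n + series (fun k => sqn (b k)) n
     <= e / 2) ->
  `|limn (series (fun n => hdot (a n) (b n)))| < e%:C.
Proof.
move=> la lb e0 ab; have /cvgrPdist_lt := cvg_hdot la lb.
have e2 : 0 < (e / 2)%:C :> R[i] by rewrite ltcR divr_gt0.
move=> /(_ _ e2)[n _ /(_ n (leqnn n)) /= h].
set l := limn _ in h *.
rewrite -(subrK (series (fun n => hdot (a n) (b n)) n) l).
apply: le_lt_trans (ler_normD _ _) _; rewrite (splitr e) rmorphD.
apply: ltr_leD h _; apply: le_trans (_ : (series (fun k => sqn (a k)) n +
  series (fun k => sqn (b k)) n)%:C <= _); last by rewrite lecR.
rewrite /series /= -big_split rmorph_sum /=.
apply: le_trans (ler_norm_sum _ _ _) _.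
by apply: ler_sum => i _; exact: hdot_le.
Qed.

End OperatorAlgebra.

(** * Expansions in Cartan triples *)

Section CartanTriple.
Context {R : realType} {H : hilbertSpace R}.
Local Notation C := R[i].
Local Notation op := (H -> H).
Context {M N D : set op} {E : op -> op}.
Context (MND : cartan_triple M N D) (fnE : faithful_normal_condexp M N E).
Implicit Types (x y z u v w e d : op).

Let aM := vna_star_algebra (cartan_vna MND).
Let aN := vna_star_algebra (cartan_subN MND).1.
Let aD := vna_star_algebra (cartan_subD MND).1.
Let NM : N `<=` M := (cartan_subN MND).2.
Let DM : D `<=` M := (cartan_subD MND).2.
Let DC := cartan_abelian MND.
Let Ecx : conditional_expectation M N E. Proof. by case: fnE. Qed.
Let bM := staralg_bounded aM.
Let lM x (Mx : M x) := bounded_linear (bM Mx).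

Lemma cartan_subDN : D `<=` N.
Proof.
move=> d Dd; rewrite (cartan_commutant MND); split; first exact: DM.
split; first exact: (staralg_bounded aD).
by move=> y Dy; exact: DC.
Qed.
Let DN := cartan_subDN.

Lemma cartan_comm n d : N n -> D d -> n \o d = d \o n.
Proof. by rewrite (cartan_commutant MND) => -[_ [_ +]]; apply. Qed.

Lemma condexpl a x : N a -> M x -> E (a \o x) = a \o E x.
Proof.
by move=> Na Mx; exact: (condexp_bimodule Ecx Mx Na (staralg_id aN)).
Qed.

Lemma condexpr a x : N a -> M x -> E (x \o a) = E x \o a.
Proof.
by move=> Na Mx; exact: (condexp_bimodule Ecx Mx (staralg_id aN) Na).
Qed.

Lemma condexp0 : E 0 = 0.
Proof. exact: (condexp_id Ecx (subspace0 (staralg_sub aN))). Qed.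

Lemma condexpD x y : M x -> M y -> E (x + y) = E x + E y.
Proof.
by move=> Mx My; have := condexp_linear Ecx 1 Mx My; rewrite !scale1r.
Qed.

Lemma condexpZ c x : M x -> E (c *: x) = c *: E x.
Proof.
move=> Mx; have := condexp_linear Ecx c Mx (subspace0 (staralg_sub aM)).
by rewrite condexp0 !addr0.
Qed.

Lemma condexpB x y : M x -> M y -> E (x - y) = E x - E y.
Proof.
move=> Mx My; rewrite condexpD//; last exact: (subspaceN (staralg_sub aM)).
by rewrite -scaleN1r condexpZ// scaleN1r.
Qed.

Lemma condexp_sum I (r : seq I) (F : I -> op) : (forall i, M (F i)) ->
  E (\sum_(i <- r) F i) = \sum_(i <- r) E (F i).
Proof.
move=> MF; elim: r => [|i r IH]; first by rewrite !big_nil condexp0.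
rewrite !big_cons condexpD ?IH//.
exact: (subspace_sum _ (staralg_sub aM)).
Qed.

(** Positivity makes [E] map [y^* y] to a self-adjoint operator, and such
    operators and the identity span [M]. *)
Lemma condexp_adj x : M x -> E (adj x) = adj (E x).
Proof.
have bE y : M y -> bounded_operator (E y).
  by move=> My; exact: (staralg_bounded aN (condexp_in Ecx My)).
(* [y + y^* = (y + 1)^* (y + 1) - y^* y - 1] *)
have re y : M y -> adj (E (y + adj y)) = E (y + adj y).
  move=> My; have My' := staralg_adj aM My.
  pose z := y + idfun; have Mz : M z.
    exact: (subspaceD (staralg_sub aM) My (staralg_id aM)).
  have -> : y + adj y = (adj z \o z) - (adj y \o y) - idfun.
    rewrite adjD ?adj_id//; [|exact: bM|exact: bounded_id].
    apply/funext => a.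
    rewrite -[RHS]/(adj y (y a + a) + (y a + a) - adj y (y a) - a).
    rewrite (linearD_op _ _ (lM My')) -[LHS]/(y a + adj y a).
    move: (y a) (adj y a) (adj y (y a)) => r q p.
    by rewrite [p + q]addrC [q + p + _]addrAC addrK addrA addrK addrC.
  have Mzz : M (adj z \o z).
    exact: (staralg_comp aM (staralg_adj aM Mz) Mz).
  have Myy : M (adj y \o y) by apply: (staralg_comp aM).
  have Mzy : M ((adj z \o z) - (adj y \o y)).
    exact: (subspaceB (staralg_sub aM)).
  rewrite condexpB//; last exact: staralg_id.
  rewrite condexpB// (condexp_id Ecx (staralg_id aN)).
  have pz := condexp_pos Ecx Mzz (adj_comp_positive (bM Mz)).
  have py := condexp_pos Ecx Myy (adj_comp_positive (bM My)).
  have bzy := subspaceB bounded_subspace pz.1 py.1.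
  rewrite adjB//; last exact: bounded_id.
  rewrite adjB ?adj_id; [|exact: pz.1|exact: py.1].
  by rewrite (positive_self_adjoint pz) (positive_self_adjoint py).
move=> Mx; have Mx' := staralg_adj aM Mx.
(* for [y = x^*], [E x + E y] and [i (E x - E y)] are self-adjoint, which
   determines the adjoint of [E x] *)
have h1 := re x Mx.
have Mix : M ('i%C *: x) by exact: (subspaceZ (staralg_sub aM)).
have := re _ Mix; move: h1.
rewrite adjZ ?conjc_i; last exact: bM.
have Mix' : M (- 'i%C *: adj x) by exact: (subspaceZ (staralg_sub aM)).
rewrite !condexpD// !condexpZ//.
have bEx := bE _ Mx; have bEx' := bE _ Mx'.
rewrite !adjD//; [|exact: (subspaceZ bounded_subspace)..].
have cni : (- 'i%C : C)^*%C = 'i%C by rewrite -conjc_i conjcK.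
rewrite (adjZ 'i%C bEx) (adjZ (- 'i%C) bEx') conjc_i cni.
move=> /(congr1 (fun t => - 'i%C *: t)) h1 h2.
move: (adj (E x)) (adj (E (adj x))) h1 h2 => X Y h1 h2.
have : - 'i%C *: (X + Y) + (- 'i%C *: X + 'i%C *: Y) =
  - 'i%C *: (E x + E (adj x)) + ('i%C *: E x + - 'i%C *: E (adj x)).
  by rewrite h1 h2.
rewrite !scalerDr !scaleNr => h.
have h' : (-2 * 'i%C) *: X = (-2 * 'i%C) *: E (adj x) :> op.
  have two (Z : op) : (-2 * 'i%C) *: Z = - ('i%C *: Z) - ('i%C *: Z).
    by rewrite mulNr scaleNr mulr_natl -scalerMnl mulr2n opprD.
  rewrite !two; move: h; rewrite addrACA [- ('i%C *: Y) + _]addrC subrr addr0.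
  by rewrite addrACA addNr add0r => ->.
apply/esym; move/(congr1 (fun t => (-2 * 'i%C)^-1 *: t)): h'.
rewrite !scalerA mulVf ?scale1r//.
by rewrite mulf_neq0// ?oppr_eq0 ?pnatr_eq0// eq_complex /= oner_eq0 andbF.
Qed.

Lemma GN_in w : GN M D w -> M w. Proof. by case. Qed.

Lemma GN_bounded w : GN M D w -> bounded_operator w.
Proof. by case=> /bM. Qed.

Lemma GN_adjl w : GN M D w -> D (adj w \o w).
Proof. by case=> _ _ /(_ _ (staralg_id aD))[]. Qed.

Lemma GN_adjr w : GN M D w -> D (w \o adj w).
Proof. by case=> _ _ /(_ _ (staralg_id aD))[]. Qed.

Lemma GN_www w a : GN M D w -> w (adj w (w a)) = w a.
Proof. by case=> _ /pi_vvv/(congr1 (@^~ a)). Qed.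

Lemma GN_www' w a : GN M D w -> adj w (w (adj w a)) = adj w a.
Proof.
move=> Gw; have bw := GN_bounded Gw; have baw := adj_bounded bw.
have [_ /pi_vvv/(congr1 (@adj R H))] := Gw.
rewrite (adj_comp (bounded_comp bw baw) bw) (adj_comp bw baw) (adjK bw).
by move=> /(congr1 (@^~ a)).
Qed.

Lemma GN_adj w : GN M D w -> GN M D (adj w).
Proof.
move=> Gw; have bw := GN_bounded Gw; have baw := adj_bounded bw.
have [Mw _ wD] := Gw; split; first exact: (staralg_adj aM).
  split=> //; split; first exact/bounded_comp/baw/adj_bounded.
    by rewrite (adj_comp (adj_bounded baw) baw) (adjK bw).
  by rewrite adjK//; apply/funext => a /=; rewrite GN_www.
by move=> d Dd; rewrite adjK//; have [] := wD d Dd.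
Qed.

Lemma D_commute d d' a : D d -> D d' -> d (d' a) = d' (d a).
Proof. by move=> Dd Dd'; exact: (congr1 (@^~ a) (DC Dd Dd')). Qed.

(** The initial projection [v^* v] and the final projection [w w^*] commute,
    both being in [D]; therefore [v w] is again a partial isometry. *)
Lemma GN_comp v w : GN M D v -> GN M D w -> GN M D (v \o w).
Proof.
move=> Gv Gw; have bv := GN_bounded Gv; have bw := GN_bounded Gw.
have bav := adj_bounded bv; have baw := adj_bounded bw.
have [Mv [_ [_ _ _]] vD] := Gv; have [Mw [_ [_ _ _]] wD] := Gw.
have avw := adj_comp bv bw.
split; first exact: (staralg_comp aM).
  split; first exact: bounded_comp.
  rewrite avw; split; first by apply: bounded_comp; exact: bounded_comp.
    rewrite (adj_comp (bounded_comp baw bav) (bounded_comp bv bw)).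
    by rewrite avw (adj_comp baw bav) !adjK.
  apply/funext => a /=.
  have h b : w (adj w (adj v (v b))) = adj v (v (w (adj w b))).
    exact: (D_commute b (GN_adjr Gw) (GN_adjl Gv)).
  by rewrite h GN_www// GN_www.
move=> d Dd; rewrite avw; split.
  exact: (wD _ (vD _ Dd).1).1.
exact: (vD _ (wD _ Dd).2).2.
Qed.

Lemma GN_projection e : D e -> projection e -> GN M D e.
Proof.
move=> De [be sae ee]; split; first exact: DM.
  by split=> //; rewrite sae ee.
move=> d Dd; rewrite sae.
by split; apply: (staralg_comp aD) => //; exact: (staralg_comp aD).
Qed.

(** Here [e] is the largest projection of [D] such that
    [w d w^* e = d w w^* e] for all [d] in [D], that is, below which
    conjugation by [w] is trivial. On the one hand, [e w] commutes with [D],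
    so [e w] is in [N] and [E (e w) = e w]. On the other hand, for [d] in [D],
    [w d w^* E w = E (w d) = (E w) d = d E w], so the range of [E w] is below
    [e] and [e E w = E w]. That [e] is in [D], and not merely in the centre of
    [N], is what makes the complementary pieces of [w] normalize [D]. *)
Lemma condexp_GN w : GN M D w ->
  exists e, [/\ D e, projection e & E w = e \o w].
Proof.
move=> Gw; have Mw := GN_in Gw; have Maw := staralg_adj aM Mw.
have [_ _ wD] := Gw.
pose l d := (w \o d \o adj w) - (d \o w \o adj w).
have Dl d : D d -> D (l d).
  move=> Dd; apply: (subspaceB (staralg_sub aD)); first exact: (wD d Dd).2.
  exact: (staralg_comp aD Dd (GN_adjr Gw)).
have [|e [De pe le eid]] :=
    @vna_kernel_projection R H D (l @` D) (cartan_subD MND).1.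
  by move=> _ [d /Dl Dd <-].
exists e; split=> //.
have lE d a : l d a = w (d (adj w a)) - d (w (adj w a)) by [].
have le' d a : D d -> w (d (adj w (e a))) = d (w (adj w (e a))).
  move=> Dd; apply/subr0_eq; rewrite -lE.
  by rewrite -[LHS]/((l d \o e) a) le//; exists d.
have Mew : M (e \o w) by apply: (staralg_comp aM) => //; exact: DM.
have New : N (e \o w).
  rewrite (cartan_commutant MND); split=> //; split; first exact: bM.
  move=> d Dd; apply/funext => a /=.
  have -> : d (e (w a)) = d (w (adj w (e (w a)))).
    have := D_commute (w a) De (GN_adjr Gw); rewrite /= => <-.
    by rewrite GN_www.
  rewrite -le'// -[RHS]/((w \o d \o adj w) (e (w a))).
  rewrite (D_commute _ (wD d Dd).2 De) /=.
  have := D_commute a Dd (GN_adjl Gw); rewrite /= => ->.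
  by rewrite GN_www.
rewrite -(condexp_id Ecx New) (condexpl (DN De) Mw); apply/funext => a /=.
apply/esym/eid => _ [d Dd <-]; rewrite lE.
have MD d' : D d' -> M d' by exact: DM.
have Ewd : (w \o d \o adj w) \o E w = E w \o d.
  rewrite -(condexpl _ Mw); last exact: DN (wD d Dd).2.
  rewrite -(condexpr (DN Dd) Mw); congr (E _); apply/funext => b /=.
  by have := D_commute b Dd (GN_adjl Gw); rewrite /= => ->; rewrite GN_www.
have Edw : (d \o w \o adj w) \o E w = E w \o d.
  rewrite (cartan_comm (condexp_in Ecx Mw) Dd) -(condexpl (DN Dd) Mw).
  rewrite -(condexpl _ Mw); last exact/DN/(staralg_comp aD Dd (GN_adjr Gw)).
  by congr (E _); apply/funext => b /=; rewrite GN_www.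
have := congr1 (@^~ a) Ewd; have := congr1 (@^~ a) Edw => /= -> ->.
exact: subrr.
Qed.

Context {Y : set op} (Ymax : maximal_E_orthogonal M D E Y).
Let GY u : Y u -> GN M D u. Proof. by case: Ymax => + _ _; apply. Qed.
Let Mc x y := @staralg_comp _ _ _ aM x y.

(** The subprojection of [v v^*] over which [v] has the form [u n] with [n] in
    [N]: the term of index [u] in the expansion of [v] is
    [overlap v u \o v]. *)
Definition overlap (v u : op) : op := u \o E (adj u \o v) \o adj v.

Lemma Madjcomp u v : M u -> M v -> M (adj u \o v).
Proof. by move=> Mu Mv; apply: Mc => //; exact: staralg_adj. Qed.

Lemma overlap_structure u v : GN M D u -> GN M D v -> exists e,
  [/\ D e, projection e, E (adj u \o v) = e \o adj u \o v
    & overlap v u = u \o e \o adj u \o (v \o adj v)].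
Proof.
move=> Gu Gv.
have [e [De pe Ee]] := condexp_GN (GN_comp (GN_adj Gu) Gv).
by exists e; rewrite /overlap Ee.
Qed.

Lemma overlap_D u v : GN M D u -> GN M D v -> D (overlap v u).
Proof.
move=> Gu Gv; have [e [De _ _ ->]] := overlap_structure Gu Gv.
have [_ _ /(_ _ De)[_ h]] := Gu.
exact: (staralg_comp aD h (GN_adjr Gv)).
Qed.

Lemma overlap_adj u v : GN M D u -> GN M D v -> adj (overlap v u) = overlap v u.
Proof.
move=> Gu Gv; have [e [De [be sae _] _ ->]] := overlap_structure Gu Gv.
have bu := GN_bounded Gu; have bv := GN_bounded Gv.
have bau := adj_bounded bu; have bav := adj_bounded bv.
have [_ _ /(_ _ De)[_ Dh]] := Gu.
have bue := bounded_comp bu be.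
rewrite (adj_comp (bounded_comp bue bau) (bounded_comp bv bav)).
rewrite (adj_comp bv bav) (adj_comp bue bau) (adj_comp bu be) sae !adjK//.
exact: (DC (GN_adjr Gv) Dh).
Qed.

Lemma overlap_absorb u v : GN M D u -> GN M D v ->
  overlap v u \o v = u \o E (adj u \o v).
Proof.
move=> Gu Gv; have Mu := GN_in Gu; have Mv := GN_in Gv.
rewrite -[LHS]/(u \o (E (adj u \o v) \o (adj v \o v))).
rewrite -(condexpr (DN (GN_adjl Gv)) (Madjcomp Mu Mv)).
by congr (u \o E _); apply/funext => a /=; rewrite (GN_www a Gv).
Qed.

Lemma overlap_idem u v : GN M D u -> GN M D v ->
  overlap v u \o overlap v u = overlap v u.
Proof.
move=> Gu Gv; have [e [De [be sae ee] _ ->]] := overlap_structure Gu Gv.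
have [_ _ /(_ _ De)[_ Dh]] := Gu.
apply/funext => a /=.
have := D_commute (v (adj v a)) (GN_adjr Gv) Dh => /= ->.
rewrite (GN_www _ Gv).
have := D_commute (adj u (v (adj v a))) De (GN_adjl Gu) => /= <-.
by rewrite (GN_www' _ Gu) -[e (e _)]/((e \o e) _) ee.
Qed.

(** The product contains the factor [E (u^* v) E (v^* u')], which is
    [E (e u^* v v^* u')] by the bimodule property; as [v v^*] commutes with
    [u u^*], this is [q E (u^* u')] for some [q] in [D], that is, zero. *)
Lemma overlap_orth u u' v : Y u -> Y u' -> u <> u' -> GN M D v ->
  overlap v u \o overlap v u' = 0.
Proof.
move=> Yu Yu' uu' Gv; have Gu := GY Yu; have Gu' := GY Yu'.
have [e [De _ Ee _]] := overlap_structure Gu Gv.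
have [e' [De' [be' sae' _] Ee' oe']] := overlap_structure Gu' Gv.
have Mu := GN_in Gu; have Mu' := GN_in Gu'; have Mv := GN_in Gv.
have bu := bM Mu; have bu' := bM Mu'; have bv := bM Mv.
have Evu : E (adj v \o u') = adj v \o u' \o e'.
  rewrite -[adj v \o u'](_ : adj (adj u' \o v) = _); last first.
    by rewrite (adj_comp (adj_bounded bu') bv) (adjK bu').
  rewrite (condexp_adj (Madjcomp Mu' Mv)) Ee'.
  have bau' := adj_bounded bu'.
  rewrite (adj_comp (bounded_comp be' bau') bv) (adj_comp be' bau').
  rewrite sae' (adjK bu').
  by rewrite (adj_comp (adj_bounded bu') bv) (adjK bu').
have EE : E (adj u \o v) \o E (adj v \o u') = 0.
  have NEe := condexp_in Ecx (Madjcomp Mu Mv).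
  rewrite -(condexpl NEe (Madjcomp Mv Mu')) Ee.
  pose q := e \o (adj u \o (v \o adj v) \o u).
  have Dq : D q.
    apply: (staralg_comp aD De).
    by have [_ _ /(_ _ (GN_adjr Gv))[]] := Gu.
  rewrite (_ : _ \o _ = q \o (adj u \o u')); last first.
    apply/funext => a; rewrite /q /=; congr (e _).
    have := D_commute (u' a) (GN_adjr Gv) (GN_adjr Gu).
    by move=> /= ->; rewrite (GN_www' _ Gu).
  rewrite (condexpl (DN Dq) (Madjcomp Mu Mu')).
  have [_ oY _] := Ymax; rewrite (oY _ _ Yu Yu' uu').
  exact/comp0r/bounded_linear/(staralg_bounded aD).
rewrite oe' -[LHS]/(u \o ((E (adj u \o v) \o (adj v \o u' \o e')) \o
  (adj u' \o (v \o adj v)))).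
by rewrite -Evu EE; apply/funext => a; exact: (linear0_op (lM Mu)).
Qed.


(** This is where maximality enters: [r v] is in [GN M D] since [r] is in [D],
    and it is [E]-orthogonal to each [u] in [Y] because [E (u^* r v) = u^* r u
    E (u^* v) = u^* r (overlap v u) v = 0]. Hence [r v] belongs to [Y], and
    being [E]-orthogonal to [Y] it is [E]-orthogonal to itself. *)
Lemma maximal_remainder v r : GN M D v -> D r -> projection r ->
  (forall u, Y u -> overlap v u \o r = 0) -> r \o v = 0.
Proof.
move=> Gv Dr pr gr; have [br sar rr] := pr; have [YG oY Ymx] := Ymax.
have Gw : GN M D (r \o v) by exact: (GN_comp (GN_projection Dr pr) Gv).
have Mw := GN_in Gw; have Mv := GN_in Gv; have bv := bM Mv.
have Euw u : Y u -> E (adj u \o (r \o v)) = 0.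
  move=> Yu; have Gu := GY Yu; have Mu := GN_in Gu; have bu := bM Mu.
  have bau := adj_bounded bu.
  have Dq : D (adj u \o r \o u) by have [_ _ /(_ _ Dr)[]] := Gu.
  rewrite (_ : _ \o _ = (adj u \o r \o u) \o (adj u \o v)); last first.
    apply/funext => a /=.
    by have := D_commute (v a) Dr (GN_adjr Gu) => /= ->; rewrite (GN_www' _ Gu).
  rewrite (condexpl (DN Dq) (Madjcomp Mu Mv)).
  have rg : r \o overlap v u = 0.
    rewrite -(overlap_adj Gu Gv) -{1}sar.
    have bg := staralg_bounded aD (overlap_D Gu Gv).
    by rewrite -(adj_comp bg br) gr// adj0.
  rewrite -[LHS]/((adj u \o r) \o (u \o E (adj u \o v))).
  rewrite -(overlap_absorb Gu Gv) -[LHS]/(adj u \o (r \o overlap v u) \o v) rg.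
  by apply/funext => a; exact: (linear0_op (bounded_linear bau)).
have Yw : Y (r \o v).
  have <- : Y `|` [set r \o v] = Y; last by right.
  apply: Ymx => [u [/YG//|->//]|u u' [Yu|->] [Yu'|->] uu'|u]; last by left.
  - exact: oY.
  - exact: Euw.
  - have Mu' := GN_in (GY Yu').
    have -> : adj (r \o v) \o u' = adj (adj u' \o (r \o v)).
      by rewrite (adj_comp (adj_bounded (bM Mu')) (bM Mw)) (adjK (bM Mu')).
    by rewrite (condexp_adj (Madjcomp Mu' Mw)) Euw// adj0.
  - by [].
have ww := Euw _ Yw.
rewrite (condexp_id Ecx) in ww; last exact: DN (GN_adjl Gw).
apply/funext => a; rewrite -(GN_www a Gw).
have -> : adj (r \o v) ((r \o v) a) = 0 by exact: (congr1 (@^~ a) ww).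
exact: linear0_op (lM Mw).
Qed.

Definition overlap_sum v (F : {fset Y}) : op :=
  \sum_(u <- F) overlap v (val u).

Lemma partial_expansionE v F : GN M D v ->
  partial_expansion E v F = overlap_sum v F \o v.
Proof.
move=> Gv; rewrite /overlap_sum comp_suml; apply: eq_bigr => u _.
by rewrite overlap_absorb//; apply: GY; exact: set_valP.
Qed.

Lemma overlap_sum_absorb v F (w : Y) : GN M D v -> w \in F ->
  overlap_sum v F \o overlap v (val w) = overlap v (val w).
Proof.
move=> Gv wF; rewrite /overlap_sum comp_suml (bigD1_seq w)//= ?fset_uniq//.
have Yw : Y (val w) by exact: set_valP.
rewrite (overlap_idem (GY Yw) Gv) big1 ?addr0// => u uw.
have Yu : Y (val u) by exact: set_valP.
by rewrite overlap_orth// => /val_inj/eqP; rewrite (negbTE uw).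
Qed.

Lemma overlap_sum_proj v F : GN M D v -> projection (overlap_sum v F).
Proof.
move=> Gv.
have Du (u : Y) : D (overlap v (val u)).
  by apply: (overlap_D _ Gv); apply: GY; exact: set_valP.
have DF : D (overlap_sum v F) by exact: (subspace_sum _ (staralg_sub aD)).
have bF := staralg_bounded aD DF.
split=> //.
  apply: adj_eq => // a b; rewrite /overlap_sum.
  elim: (enum_fset F) => [|u r IH]; first by rewrite big_nil hdot0l hdot0r.
  rewrite !big_cons !fctE hdotDl hdotDr IH; congr (_ + _).
  rewrite (hdot_adjr _ _ (staralg_bounded aD (Du u))) overlap_adj//.
  by apply: GY; exact: set_valP.
rewrite {2}/overlap_sum comp_sumr; last exact: bounded_linear bF.
by apply: eq_big_seq => u uF; exact: overlap_sum_absorb.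
Qed.

(** In l2(H), the sequence [v c] lies in the closure of the ranges of the
    projections [overlap_sum v F]. Indeed, the entries of a sequence that is
    orthogonal to all these ranges are in the common kernel of the overlaps;
    let [r] be the projection on this kernel. Such a sequence is orthogonal to
    [v c] because [r v = 0]. *)
Lemma GN_expansion_cvg v (c : nat -> H) (e : R) : GN M D v -> l2 c -> 0 < e ->
  exists F0 : {fset Y}, forall F : {fset Y}, (F0 `<=` F)%fset -> forall n,
    series (fun k => sqn ((v - partial_expansion E v F) (c k))) n <= e.
Proof.
move=> Gv lc e0; have Mv := GN_in Gv.
have lvc := l2_image (bM Mv) lc.
have lF F : linear (overlap_sum v F) by case: (overlap_sum_proj F Gv) => -[].
pose S := [set s : nat -> H | l2 s /\ exists F0 : {fset Y},
  forall F : {fset Y}, (F0 `<=` F)%fset ->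
    forall n, overlap_sum v F (s n) = s n].
have sS : subspace S.
  split.
  - split; first exact: (subspace0 l2_sub).
    by exists fset0 => F _ n; exact: linear0_op (lF F).
  - move=> s t [ls [F1 h1]] [lt [F2 h2]].
    split; first exact: (subspaceD l2_sub).
    exists (F1 `|` F2)%fset => F.
    rewrite fsubUset => /andP[/h1 {}h1 /h2 {}h2] n.
    by rewrite [LHS](linearD_op _ _ (lF F)) h1 h2.
  - move=> k s [ls [F1 h1]]; split; first exact: (subspaceZ l2_sub).
    by exists F1 => F /h1{}h1 n; rewrite [LHS](linearZ_op _ _ (lF F)) h1.
have [s []//|d ld dS|s [ls [F0 F0s]] sv] :=
    orth_dense inner_l2 complete_l2 sS _ lvc _ e0.
- have [|r [Dr pr gr rid]] :=
      @vna_kernel_projection R H D (overlap v @` Y) (cartan_subD MND).1.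
    by move=> _ [u Yu <-]; apply: overlap_D => //; exact: GY.
  have rv : r \o v = 0.
    by apply: (maximal_remainder Gv Dr pr) => u Yu; apply: gr; exists u.
  have rd n : r (d n) = d n.
    apply: rid => _ [u Yu <-]; have Gu := GY Yu.
    have Dg := overlap_D Gu Gv; have bg := staralg_bounded aD Dg.
    apply: sqn_eq0; rewrite /sqn /rdot (hdot_adjr _ _ bg) (overlap_adj Gu Gv).
    rewrite -/(rdot _ _) -l2dot_single; apply: dS.
    split; first exact: l2_single.
    exists [fset SigSub (mem_set Yu)]%fset => F; rewrite fsub1set => uF m.
    rewrite /single; case: eqP => _; last exact: linear0_op (lF F).
    exact: (congr1 (@^~ (overlap v u (d n))) (overlap_sum_absorb Gv uF)).
  rewrite /l2dot (_ : series _ = cst 0) ?lim_cst//.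
  apply/funext => n; rewrite /series /= big1// => i _.
  have [br sar _] := pr.
  rewrite -rd /rdot (hdot_adjr _ _ br) sar.
  by rewrite -[r (v _)]/((r \o v) _) rv hdot0r.
exists F0 => F /F0s{}F0s n.
apply: le_trans (ltW sv).
apply: le_trans (l2_series_le n (subspaceB l2_sub lvc ls)).
apply: ler_sum => i _; rewrite partial_expansionE//.
have -> : (v - (overlap_sum v F \o v)) (c i) =
    (v (c i) - s i) - overlap_sum v F (v (c i) - s i).
  rewrite (linearB_op _ _ (lF F)) F0s opprB.
  by rewrite addrA subrK.
exact: projection_complement_contract (overlap_sum_proj F Gv).
Qed.


Lemma GN_span_in : linear_span (GN M D) `<=` M.
Proof. by apply: (linear_span_min (staralg_sub aM)) => v /GN_in. Qed.

(** If [d] is orthogonal to [y c] for all [y] in the span of [GN M D], then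
    the normal functional [y |-> sum_n <y c_n, d_n>] vanishes on this span,
    hence at [x] by weak-* density. *)
Lemma regular_l2_dense x (c : nat -> H) (e : R) : M x -> l2 c -> 0 < e ->
  exists2 y, linear_span (GN M D) y &
    forall n, series (fun k => sqn ((x - y) (c k))) n <= e.
Proof.
move=> Mx lc e0; have lxc := l2_image (bM Mx) lc.
pose S := [set (fun n => y (c n)) | y in linear_span (GN M D)].
have sG := @linear_span_sub R _ (GN M D).
have sS : subspace S.
  split; first by exists 0 => //; exact: (subspace0 sG).
    move=> _ _ [y Sy <-] [z Sz <-]; exists (y + z) => //; exact: (subspaceD sG).
  move=> k _ [y Sy <-]; exists (k *: y) => //; exact: (subspaceZ sG).
have lS : S `<=` l2.
  by move=> _ [y /GN_span_in My <-]; exact: l2_image (bM My) lc.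
have [d ld dS|_ [y Sy <-] ye] := orth_dense inner_l2 complete_l2 sS lS lxc _ e0.
  pose phi (y : op) : C := limn (series (fun n => hdot (y (c n)) (d n))).
  have phiM : predual M phi.
    by exists c, d; split=> //; exact/square_summableE.
  apply/eqP; rewrite -normr_eq0 eq_le normr_ge0 andbT.
  apply/ler_addgt0Pl => k k0; rewrite addr0.
  have [|y [yk Sy]] :=
      cartan_regular MND Mx (U := [set y | `|phi (y - x)| < k%:C]).
    exists 1%N, (fun _ y => `|phi y|), k%:C; split.
    - by move=> i; exists phi.
    - by rewrite ltcR.
    - by move=> y _ /(_ ord0).
  have My := GN_span_in Sy.
  have Mxy := subspaceB (staralg_sub aM) My Mx.
  have lyc := l2_image (bM My) lc.
  have E1 : complex.Re (phi (y - x)) = - l2dot d (fun n => x (c n)).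
    rewrite [LHS](Re_lim_hdot (l2_image (bM Mxy) lc) ld).
    rewrite (_ : (fun n => _) = (fun n => y (c n)) - (fun n => x (c n)))//.
    rewrite (innerBl inner_l2)// (innerC inner_l2 lyc ld) dS ?sub0r.
      by rewrite (innerC inner_l2).
    by exists y.
  rewrite -normrN -E1 -lecR; apply: le_trans (normc_ge_Re _) _.
  exact: ltW.
exists y => // n.
have lz := subspaceB l2_sub lxc (l2_image (bM (GN_span_in Sy)) lc).
exact: le_trans (l2_series_le n lz) (ltW ye).
Qed.

(** By normality of [E], [rho (E z)] is small once finitely many normal
    functionals [z |-> sum_n <z a_n, b_n>] are small. At [z = y^* y] such a
    functional is [sum_n <y a_n, y b_n>], which the squared l2-norms of [y a]
    and [y b] dominate. *)
Lemma normal_dominated rho (e : R) : positive_predual N rho -> 0 < e ->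
  exists2 c : nat -> H, l2 c & exists2 k : R, 0 < k & forall y, M y ->
    (forall n, series (fun m => sqn (y (c m))) n <= k) ->
    complex.Re (rho (E (adj y \o y))) < e.
Proof.
move=> [rhoN _] e0.
have M0 : M 0 by exact: subspace0 (staralg_sub aM).
have nE : normal_map M N E by case: fnE.
have [|n [p [k [pP k0 kU]]]] := nE 0 M0 [set z | `|rho (z - E 0)| < e%:C].
  exists 1%N, (fun _ y => `|rho y|), e%:C; split.
  - by move=> i; exists rho.
  - by rewrite ltcR.
  - by move=> y _ /(_ ord0).
have /choice[ab abP] i : exists ab : (nat -> H) * (nat -> H),
    [/\ l2 ab.1, l2 ab.2 & forall y, M y ->
      p i y = `|limn (series (fun n => hdot (y (ab.1 n)) (ab.2 n)))|].
  have [phi [a [b [la lb phiE]]] ->] := pP i.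
  move: la lb => /square_summableE la /square_summableE lb.
  by exists (a, b); split=> // y My; rewrite phiE.
have [|c lc cP] := @l2_merge _ _ n (fun i => interleave (ab i).1 (ab i).2).
  by move=> i; have [la lb _] := abP i; exact: l2_interleave.
have [r r0 rE] := real_complex_gt0 k0.
exists c => //; exists (r / 2); first by rewrite divr_gt0.
move=> y My yc; have Myy : M (adj y \o y) by exact: Madjcomp.
have : `|rho (E (adj y \o y) - E 0)| < e%:C.
  apply: kU => // i; rewrite subr0 rE; have [la lb ->//] := abP i.
  have lya := l2_image (bM My) la; have lyb := l2_image (bM My) lb.
  rewrite (_ : (fun n => _) =
    (fun n => hdot (y ((ab i).1 n)) (y ((ab i).2 n)))); last first.
    by apply/funext => m /=; rewrite (hdot_adjl _ _ (bM My)).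
  apply: norm_lim_hdot_lt => // m.
  rewrite -(series_interleave _ _ (fun h => sqn (y h))).
  by apply: (cP (fun h => sqn (y h))) => // h; exact: sqn_ge0.
rewrite condexp0 subr0 -ltcR => h; apply: le_lt_trans h.
apply: le_trans (normc_ge_Re _); rewrite lecR; exact: ler_norm.
Qed.

Lemma predualD rho x y : predual N rho -> N x -> N y ->
  rho (x + y) = rho x + rho y.
Proof.
move=> [a [b [/square_summableE la /square_summableE lb rhoE]]] Nx Ny.
have bx := staralg_bounded aN Nx; have bY := staralg_bounded aN Ny.
rewrite !rhoE//; last exact: (subspaceD (staralg_sub aN)).
apply: etrans (limD (cvg_hdot (l2_image bx la) lb)
  (cvg_hdot (l2_image bY la) lb)).
congr (limn _); apply/funext => n.
apply: (@etrans _ _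
  (\sum_(0 <= i < n) (hdot (x (a i)) (b i) + hdot (y (a i)) (b i)))).
  by apply: eq_bigr => i _; rewrite hdotDl.
by rewrite big_split.
Qed.

Lemma expansion_in x (F : {fset Y}) : M x -> M (partial_expansion E x F).
Proof.
move=> Mx; apply: (subspace_sum _ (staralg_sub aM)) => u.
have Mu := GN_in (GY (set_valP u)).
by apply: Mc => //; apply/NM/(condexp_in Ecx)/Madjcomp.
Qed.

Lemma expansionD x y (F : {fset Y}) : M x -> M y ->
  partial_expansion E (x + y) F =
  partial_expansion E x F + partial_expansion E y F :> op.
Proof.
move=> Mx My; rewrite -big_split /=; apply: eq_bigr => u _.
have Mu : M (val (u : Y)) := GN_in (GY (set_valP u)).
rewrite (compDr _ _ (lM (staralg_adj aM Mu))).
by rewrite (condexpD (Madjcomp Mu Mx) (Madjcomp Mu My)) (compDr _ _ (lM Mu)).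
Qed.

Lemma expansionZ k x (F : {fset Y}) : M x ->
  partial_expansion E (k *: x) F = k *: partial_expansion E x F :> op.
Proof.
move=> Mx; rewrite scaler_sumr; apply: eq_bigr => u _.
have Mu : M (val (u : Y)) := GN_in (GY (set_valP u)).
rewrite (compZr _ _ (lM (staralg_adj aM Mu))).
by rewrite (condexpZ _ (Madjcomp Mu Mx)) (compZr _ _ (lM Mu)).
Qed.

Lemma span_expansion_cvg y (c : nat -> H) (e : R) :
  linear_span (GN M D) y -> l2 c -> 0 < e ->
  exists F0 : {fset Y}, forall F : {fset Y}, (F0 `<=` F)%fset -> forall n,
    series (fun k => sqn ((y - partial_expansion E y F) (c k))) n <= e.
Proof.
move=> Sy lc; move: e.
pose A := [set y | M y /\ forall e : R, 0 < e ->
  exists F0 : {fset Y}, forall F : {fset Y}, (F0 `<=` F)%fset -> forall n,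
    series (fun k => sqn ((y - partial_expansion E y F) (c k))) n <= e].
suff sA : subspace A.
  have [|//] := linear_span_min sA _ Sy.
  by move=> v Gv; split=> [|e]; [exact: GN_in|exact: GN_expansion_cvg].
split.
- split; first exact: subspace0 (staralg_sub aM).
  move=> e e0; exists fset0 => F _ n.
  have -> : partial_expansion E 0 F = 0 :> op.
    by have := expansionZ 0 F (subspace0 (staralg_sub aM)); rewrite !scale0r.
  by rewrite subrr /series /= big1 ?ltW// => i _; exact: sqn0.
- move=> x z [Mx xA] [Mz zA]; split; first exact: (subspaceD (staralg_sub aM)).
  move=> e e0; have e4 : 0 < e / 4 by rewrite divr_gt0.
  have [F1 h1] := xA _ e4; have [F2 h2] := zA _ e4.
  exists (F1 `|` F2)%fset => F; rewrite fsubUset => /andP[/h1 {}h1 /h2 {}h2] n.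
  rewrite expansionD// opprD addrACA.
  have := h1 n; have := h2 n; move: (x - _) (z - _) => s t {}h2 {}h1.
  apply: (@le_trans _ _ (2 * series (fun k => sqn (s (c k))) n +
     2 * series (fun k => sqn (t (c k))) n)).
    rewrite /series /= !mulr_sumr -big_split /=; apply: ler_sum => i _.
    exact: sqnD_le.
  by move: (series _ _) (series _ _) h1 h2 => p q; lra.
- move=> k x [Mx xA]; split; first exact: (subspaceZ (staralg_sub aM)).
  move=> e e0; pose K := complex.Re (`|k| ^+ 2).
  have K0 : 0 <= K.
    by rewrite /K -add_Re2_Im2 /=; apply: addr_ge0; exact: sqr_ge0.
  have K1 : 0 < K + 1 by lra.
  have [F0 h] := xA _ (divr_gt0 e0 K1); exists F0 => F /h {}h n.
  rewrite expansionZ// -scalerBr.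
  apply: (@le_trans _ _ ((K + 1) * (e / (K + 1)))); last first.
    by rewrite mulrC divfK// gt_eqF.
  apply: le_trans (ler_wpM2l (ltW K1) (h n)).
  rewrite /series /= mulr_sumr; apply: ler_sum => i _; rewrite sqnZ -/K.
  by rewrite ler_wpM2r ?sqn_ge0//; lra.
Qed.

(** The expansion is an orthogonal projection: by [E]-orthogonality only the
    term of index [u] of the expansion survives, and [E (u^* u E (u^* x)) = E
    (u^* u u^* x) = E (u^* x)]. *)
Lemma expansion_orth x (F : {fset Y}) (u : Y) : M x -> u \in F ->
  E (adj (val u) \o (x - partial_expansion E x F)) = 0.
Proof.
move=> Mx uF; have Yu : Y (val u) by exact: set_valP.
have Gu := GY Yu; have Mu := GN_in Gu; have Mx' := expansion_in F Mx.
have Ma := staralg_adj aM Mu.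
rewrite (compBr _ _ (lM Ma)) (condexpB (Madjcomp Mu Mx) (Madjcomp Mu Mx')).
have MG (w : Y) : M (val w) := GN_in (GY (set_valP w)).
have NE (w : Y) : N (E (adj (val w) \o x)).
  by apply: (condexp_in Ecx); exact: Madjcomp.
rewrite /partial_expansion (comp_sumr _ _ (lM Ma)) condexp_sum; last first.
  by move=> w; apply: Mc => //; apply: Mc => //; exact/NM.
rewrite (bigD1_seq u)//= ?fset_uniq// big1 ?addr0.
  rewrite -[adj (val u) \o (val u \o _)]/((adj (val u) \o val u) \o _).
  rewrite (condexpr (NE u) (Madjcomp Mu Mu)) (condexp_id Ecx (DN (GN_adjl Gu))).
  rewrite -(condexpl (DN (GN_adjl Gu)) (Madjcomp Mu Mx)).
  rewrite (_ : _ \o (adj (val u) \o x) = adj (val u) \o x) ?subrr//.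
  by apply/funext => a /=; rewrite (GN_www' _ Gu).
move=> w wu.
rewrite -[adj (val u) \o (val w \o _)]/((adj (val u) \o val w) \o _).
rewrite (condexpr (NE w) (Madjcomp Mu (MG w))).
have [_ oY _] := Ymax; rewrite (oY _ _ Yu (set_valP w))//.
by move=> /val_inj uw; rewrite uw eqxx in wu.
Qed.

(** Pythagoras: the cross terms vanish by [expansion_orth]. *)
Lemma bessel x (F : {fset Y}) : M x ->
  let y := partial_expansion E x F in
  E (adj x \o x) = E (adj y \o y) + E (adj (x - y) \o (x - y)).
Proof.
move=> Mx y; have My : M y by exact: expansion_in.
pose r := x - y; have Mr : M r by exact: (subspaceB (staralg_sub aM)).
have MG (w : Y) : M (val w) := GN_in (GY (set_valP w)).
have NE (w : Y) : N (E (adj (val w) \o x)).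
  by apply: (condexp_in Ecx); exact: Madjcomp.
have adjE u v : M u -> M v -> E (adj u \o v) = adj (E (adj v \o u)).
  move=> Mu Mv; rewrite -(condexp_adj (Madjcomp Mv Mu)).
  by rewrite (adj_comp (adj_bounded (bM Mv)) (bM Mu)) (adjK (bM Mv)).
have ry : E (adj r \o y) = 0.
  have lr := lM (staralg_adj aM Mr).
  rewrite /y /partial_expansion (comp_sumr _ _ lr) condexp_sum; last first.
    move=> w; apply: (Mc (staralg_adj aM Mr)); apply: Mc => //; exact/NM.
  rewrite big_seq big1// => w wF.
  rewrite -[adj r \o (val w \o _)]/((adj r \o val w) \o _).
  rewrite (condexpr (NE w) (Madjcomp Mr (MG w))) (adjE _ _ Mr (MG w)).
  by rewrite (expansion_orth Mx wF) adj0.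
have yr : E (adj y \o r) = 0 by rewrite (adjE _ _ My Mr) ry adj0.
have -> : adj x \o x =
    (adj y \o y) + (adj r \o y) + ((adj y \o r) + (adj r \o r)).
  have {1 2}-> : x = y + r by rewrite /r addrC subrK.
  have Myr := subspaceD (staralg_sub aM) My Mr.
  rewrite (compDr _ _ (lM (staralg_adj aM Myr))).
  by rewrite (adjD (bM My) (bM Mr)).
have sM := staralg_sub aM.
rewrite !condexpD ?ry ?yr ?addr0 ?add0r//; try (exact: Madjcomp).
  by apply: (subspaceD sM); exact: Madjcomp.
by apply: (subspaceD sM); exact: Madjcomp.
Qed.


Lemma comp_adj_parallelogram x y : M x -> M y ->
  (adj (x + y) \o (x + y)) + (adj (x - y) \o (x - y)) =
  ((adj x \o x) + (adj x \o x)) + ((adj y \o y) + (adj y \o y)).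
Proof.
move=> Mx My.
have lx := lM (staralg_adj aM Mx); have ly := lM (staralg_adj aM My).
rewrite (adjD (bM Mx) (bM My)) (adjB (bM Mx) (bM My)); apply/funext => a.
rewrite -[LHS]/(adj x (x a + y a) + adj y (x a + y a) +
                (adj x (x a - y a) - adj y (x a - y a))).
rewrite !(linearD_op _ _ lx) !(linearD_op _ _ ly) !(linearN_op _ lx).
rewrite !(linearN_op _ ly).
rewrite -[RHS]/((adj x (x a) + adj x (x a)) + (adj y (y a) + adj y (y a))).
move: (adj x (x a)) (adj x (y a)) (adj y (x a)) (adj y (y a)) => p q r s.
rewrite opprB addrACA [p + q + _]addrACA subrr addr0 [r + s]addrC.
by rewrite [s + r + _]addrACA subrr addr0.
Qed.

(** Put [q y := rho (E (y^* y))]. For [y] in the span of [GN M D] and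
    [z := x - y], the parallelogram law and [bessel] give [q (x_F - x) <= 2 q
    (y - y_F) + 2 q (z - z_F) <= 2 q (y - y_F) + 2 q z]; here [q z] is small
    for a good choice of [y], and then [q (y - y_F)] is small for large
    [F]. *)
Lemma expansion_bures_cvg rho x (e : R) : positive_predual N rho -> M x ->
  0 < e -> exists F0 : {fset Y}, forall F : {fset Y}, (F0 `<=` F)%fset ->
    complex.Re (rho (E (adj (partial_expansion E x F - x) \o
                        (partial_expansion E x F - x)))) < e.
Proof.
move=> rhoP Mx e0; have sM := staralg_sub aM; have rhoN := rhoP.1.
pose q y := complex.Re (rho (E (adj y \o y))).
have NE y : M y -> N (E (adj y \o y)).
  by move=> My; apply: (condexp_in Ecx); exact: Madjcomp.
have q0 y : M y -> 0 <= q y.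
  move=> My; have := rhoP.2 _ (NE _ My).
  move=> /(_ (condexp_pos Ecx (Madjcomp My My) (adj_comp_positive (bM My)))).
  by rewrite lecE => /andP[].
have rhoD u v : N u -> N v ->
    complex.Re (rho (u + v)) = complex.Re (rho u) + complex.Re (rho v).
  by move=> Nu Nv; rewrite (predualD rhoN Nu Nv) raddfD.
have qD y z : M y -> M z -> q (y + z) <= 2 * q y + 2 * q z.
  move=> My Mz; have := q0 _ (subspaceB sM My Mz).
  have MD := subspaceD sM My Mz; have MB := subspaceB sM My Mz.
  have sN := staralg_sub aN.
  have h : q (y + z) + q (y - z) = (q y + q y) + (q z + q z).
    rewrite /q -!rhoD; try (exact: NE); try (apply: (subspaceD sN); exact: NE).
    rewrite -!condexpD; try (exact: Madjcomp);
      try (apply: (subspaceD sM); exact: Madjcomp).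
    by rewrite comp_adj_parallelogram.
  by move: h; lra.
have qN y : M y -> q (- y) = q y.
  move=> My; congr (complex.Re (rho (E _))); rewrite (adjN (bM My)).
  apply/funext => a /=; rewrite -[LHS]/(- adj y (- y a)).
  by rewrite (linearN_op _ (lM (staralg_adj aM My))) opprK.
have q_bessel y (F : {fset Y}) : M y -> q (y - partial_expansion E y F) <= q y.
  move=> My; have MF := expansion_in F My; have MB := subspaceB sM My MF.
  rewrite {2}/q (bessel F My) (rhoD _ _ (NE _ MF) (NE _ MB)) lerDr.
  exact: q0.
have e8 : 0 < e / 8 by rewrite divr_gt0.
have [c lc [k k0 ck]] := normal_dominated rhoP e8.
have [y Sy yx] := regular_l2_dense Mx lc k0.
have [F0 F0y] := span_expansion_cvg Sy lc k0.
have My := GN_span_in Sy; have Mz := subspaceB sM Mx My.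
exists F0 => F /F0y {}F0y.
have MyF := subspaceB sM My (expansion_in F My).
have MzF := subspaceB sM Mz (expansion_in F Mz).
have -> : partial_expansion E x F - x =
    - ((y - partial_expansion E y F) +
       ((x - y) - partial_expansion E (x - y) F)).
  have {1}-> : x = y + (x - y) by rewrite addrC subrK.
  by rewrite (expansionD F My Mz) addrACA -opprD [y + _]addrC subrK opprB.
rewrite -/(q _) qN; last exact: (subspaceD sM).
apply: le_lt_trans (qD _ _ MyF MzF) _.
have h1 : q (y - partial_expansion E y F) < e / 8 by apply: ck.
have h2 := q_bessel _ F Mz.
have h3 : q (x - y) < e / 8 by apply: ck.
by move: h1 h2 h3; lra.
Qed.

End CartanTriple.

(** * Convergence of the net of expansions *)

Theorem theorem5p7 (R : realType) (H : hilbertSpace R)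
    (M N D : set (H -> H)) (E : (H -> H) -> (H -> H)) (Y : set (H -> H)) :
  cartan_triple M N D ->
  faithful_normal_condexp M N E ->
  maximal_E_orthogonal M D E Y ->
  forall x : H -> H, M x ->
    partial_expansion E x F @[F --> finite_subsets_filter Y]
      --> bures_nbhs M N E x.
Proof.
move=> MND fnE Ymax x Mx U [n [p [e [pP /real_complex_gt0[r r0 ->] pU]]]].
have /choice[F0 F0P] i : exists F0 : {fset Y}, forall F : {fset Y},
    (F0 `<=` F)%fset -> p i (partial_expansion E x F - x) < r%:C.
  have [rho rhoP ->] := pP i.
  have [F0 F0P] := expansion_bures_cvg MND fnE Ymax rhoP Mx (exprn_gt0 2 r0).
  exists F0 => F /F0P; set y := partial_expansion E x F - x => h.
  have My : M y.
    apply: (subspaceB (staralg_sub (vna_star_algebra (cartan_vna MND)))) => //.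
    exact: (expansion_in MND fnE Ymax).
  have rho0 : 0 <= rho (E (adj y \o y)).
    have Myy := Madjcomp MND My My; have [Ecx _ _] := fnE.
    apply: rhoP.2; first exact: (condexp_in Ecx).
    apply: (condexp_pos Ecx) => //; apply: adj_comp_positive.
    exact: (vna_bounded (cartan_vna MND)).
  (* compare the squares of the seminorm and of the radius *)
  rewrite -(ltr_pXn2r (ltn0Sn 1)) ?nnegrE ?sqrtC_ge0//; last first.
    by rewrite lecE /= eqxx ltW.
  by rewrite sqrtCK -(RRe_real (ger0_real rho0)) -rmorphXn /= ltcR.
exists (\big[fsetU/fset0]_(i < n) F0 i) => // F /= FF.
apply: pU; first exact: (expansion_in MND fnE Ymax).
move=> i; apply: F0P; apply: fsubset_trans FF.
exact: (bigfcup_sup F0 (mem_index_enum i) isT).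
Qed.
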